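(* Let $\mathcal{L}=\mathcal{H}+\mathcal{D}$ be a time-independent Lindbladian on a finite-dimensional $n$-qubit system, with Hamiltonian portion $\mathcal{H}(\rho)=-i[H,\rho]$ and dissipative portion $\mathcal{D}(\rho)=\sum_{\mu=1}^{m}\left(L_\mu\rho L_\mu^\dagger-\tfrac12\{L_\mu^\dagger L_\mu,\rho\}\right)$. Assume $\mathcal{D}$ generates an approximately stochastically simulatable channel, i.e. there are a constant $c_0\ge 0$ and, for each time step $\delta t>0$ with $\left(\tfrac12\|\mathcal{H}\|_\diamond+\|\mathcal{D}\|_\diamond\right)\delta t\le 1$, a stochastically simulatable channel $\mathcal{N}_{\delta t}=\sum_i p_i(\delta t)\,\mathcal{A}^{(i)}_{\delta t}$ such that $$\left\|e^{\delta t\mathcal{D}}-\mathcal{N}_{\delta t}\right\|_\diamond\le c_0\left(\|\mathcal{D}\|_\diamond\,\delta t\right)^3 .$$ Let $T>0$ and $\epsilon>0$. Then there exists a quantum algorithm that simulates $e^{T\mathcal{L}}$ up to precision $\epsilon$ (in diamond norm) and that requires $$r=O\!\left(\sqrt{\frac{1+6c_0}{\epsilon}}\,\left(\|\mathcal{L}\|_{pauli}\,T\right)^{1.5}\right)$$ calls to the oracles $\mathcal{A}^{(i)}_{\delta t}$ and to any Hamiltonian simulation subroutine $\mathcal{K}_{\delta t}$, where $\delta t=T/r$ (in the regime where this time step satisfies $\left(\tfrac12\|\mathcal{H}\|_\diamond+\|\mathcal{D}\|_\diamond\right)\delta t\le 1$, and where the subroutine $\mathcal{K}_{\delta t}$ has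 precision $\epsilon_H=O(\epsilon/r)$). No ancilla qubits are needed beyond what is required for the Hamiltonian simulation subroutine $\mathcal{K}_{\delta t}$.
   Context: Norms. For a linear map $\mathcal{M}$ on operators on a finite-dimensional Hilbert space, $\|\mathcal{M}\|_\diamond=\max_{\|\rho\|_1=1}\|(\mathcal{I}\otimes\mathcal{M})(\rho)\|_1$, where $\|\cdot\|_1$ is the trace norm and $\mathcal{I}$ is the identity map (on an ancillary system of the same dimension). The Pauli norm: write $H=\sum_{k=0}^{s-1}\beta_{0k}V_{0k}$ and $L_\mu=\sum_{k=0}^{s-1}\beta_{\mu k}V_{\mu k}$ with $\beta_{\mu k}>0$ and each $V_{\mu k}$ an $n$-fold tensor product of Pauli operators with an arbitrary phase; then $\|\mathcal{L}\|_{pauli}=\sum_{k=0}^{s-1}\beta_{0k}+\sum_{\mu=1}^{m}\left(\sum_{k=0}^{s-1}\beta_{\mu k}\right)^2$. Stochastically simulatable channel. A channel $\mathcal{E}$ is stochastically simulatable if $\mathcal{E}(\rho)=q\left(\sum_i\lambda_iU_i\rho U_i^\dagger\right)+(1-q)\rho_f$, where the $U_i$ are unitary, $\rho_f$ is a fixed quantum state, $0\le q\le1$, $0\le\lambda_i\le1$ and $\sum_i\lambda_i=1$. For $\mathcal{N}_{\delta t}$ of this form (with $q(\delta t)$, $\lambda_i(\delta t)$, $U^{(i)}_{\delta t}$ and fixed state $\rho_{\delta t}$), the oracles are $\mathcal{A}^{(0)}_{\delta t}(\rho)=\rho_{\delta t}$ (fixed state preparation) and $\mathcal{A}^{(i)}_{\delta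 t}(\rho)=U^{(i)}_{\delta t}\rho U^{(i)\dagger}_{\delta t}$ for $i\neq0$, with probabilities $p_0(\delta t)=1-q(\delta t)$ and $p_i(\delta t)=q(\delta t)\lambda_i(\delta t)$ for $i\ne 0$. Computational model. An algorithm is a randomly compiled circuit: at compilation, indices $i$ may be sampled from the classical distributions $p_i(\delta t)$ and the corresponding oracles $\mathcal{A}^{(i)}_{\delta t}$ applied, interleaved with calls to $\mathcal{K}_{\delta t}$. It simulates $e^{T\mathcal{L}}$ up to precision $\epsilon$ if the channel obtained by averaging over the random compilation differs from $e^{T\mathcal{L}}$ by at most $O(\epsilon)$ in diamond norm (equivalently up to a constant rescaling of $\epsilon$, at most $\epsilon$). A Hamiltonian simulation subroutine $\mathcal{K}_{\delta t}$ of precision $\epsilon_H$ is any quantum channel on the system (possibly implemented with its own ancillas) with $\|e^{\frac{\delta t}{2}\mathcal{H}}-\mathcal{K}_{\delta t}\|_\diamond\le\epsilon_H$. The constants in $O(\cdot)$ are absolute. *)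

(* Defs.v *)
From HB Require Import structures.
From mathcomp Require Import all_boot all_order all_algebra.
From mathcomp Require Import complex mxtens.
From mathcomp Require Import all_classical all_reals all_analysis.

Set Implicit Arguments.
Unset Strict Implicit.
Unset Printing Implicit Defensive.

Import Order.TTheory GRing.Theory Num.Theory numFieldNormedType.Exports.

Local Open Scope classical_set_scope.
Local Open Scope ring_scope.
Local Open Scope complex_scope.
Local Open Scope sesquilinear_scope.

(* Complex matrices, seen over a [numFieldType] so that the topology (hence
   limits) of matrices is found by inference. *)
Notation "''MC[' R ]_ d" := 'M[(complex R : numFieldType)]_d
  (at level 8, d at level 2, format "''MC[' R ]_ d") : type_scope.

Section Operators.
Variable R : realType.

(* 0 <= z in R[i] forces z to be real, so this includes hermitianity. *)
Definition psdmx d (A : 'MC[R]_d) : Prop :=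
  forall v : 'rV[R[i]]_d, 0 <= (v *m A *m v ^t*) 0 0.

Definition density d (rho : 'MC[R]_d) : Prop := psdmx rho /\ \tr rho = 1.

(* Sum of the singular values: [spectral_diag] lists the eigenvalues, with
   multiplicity, of the normal matrix A^* A. *)
Definition trace_norm d (A : 'MC[R]_d) : R :=
  \sum_i Num.sqrt (complex.Re (spectral_diag (A ^t* *m A) 0 i)).

Definition tens_block k d (rho : 'MC[R]_(k * d)) (i j : 'I_k) : 'MC[R]_d :=
  \matrix_(a, b) rho (mxtens_index (i, a)) (mxtens_index (j, b)).

(* I_k (x) M, for linear M: rho = \sum_ij |i><j| (x) rho_ij is sent to
   \sum_ij |i><j| (x) M rho_ij. *)
Definition tens_id k d (M : 'MC[R]_d -> 'MC[R]_d) (rho : 'MC[R]_(k * d)) :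
    'MC[R]_(k * d) :=
  \sum_(i < k) \sum_(j < k) (delta_mx i j : 'MC[R]_k) *t M (tens_block rho i j).

(* For linear M the set is bounded and closed, so that the supremum is a
   maximum; rho ranges over all operators of unit trace norm. *)
Definition diamond_norm d (M : 'MC[R]_d -> 'MC[R]_d) : R :=
  sup [set trace_norm (tens_id (k := d) M rho)
      | rho in [set rho : 'MC[R]_(d * d) | trace_norm rho = 1]].

Record quantum_channel d (M : 'MC[R]_d -> 'MC[R]_d) : Prop := QuantumChannel {
  channel_linear : linear M;
  channel_cp : forall k (rho : 'MC[R]_(k * d)),
    psdmx rho -> psdmx (tens_id M rho);
  channel_tp : forall rho, \tr (M rho) = \tr rho
}.

Definition hamiltonian_part d (H : 'MC[R]_d) (rho : 'MC[R]_d) : 'MC[R]_d :=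
  - 'i *: (H *m rho - rho *m H).

Definition dissipative_part d m (L : 'I_m -> 'MC[R]_d) (rho : 'MC[R]_d) :
    'MC[R]_d :=
  \sum_mu (L mu *m rho *m (L mu) ^t*
    - 2^-1 *: ((L mu) ^t* *m L mu *m rho + rho *m ((L mu) ^t* *m L mu))).

Definition lindbladian d m (H : 'MC[R]_d) (L : 'I_m -> 'MC[R]_d)
    (rho : 'MC[R]_d) : 'MC[R]_d :=
  hamiltonian_part H rho + dissipative_part L rho.

(* e^{t M}, as a power series applied to rho. *)
Definition exp_super d (t : R) (M : 'MC[R]_d -> 'MC[R]_d) (rho : 'MC[R]_d) :
    'MC[R]_d :=
  limn (fun j : nat => \sum_(k < j) (t ^+ k / k`!%:R)%:C *: iter k M rho).

End Operators.

Section Pauli.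
Variable R : realType.

Inductive pauli := PauliI | PauliX | PauliY | PauliZ.

Definition pauli_mx (p : pauli) : 'MC[R]_2 :=
  \matrix_(i, j)
    match p with
    | PauliI => if i == j then 1 else 0
    | PauliX => if i == j then 0 else 1
    | PauliY => if i == j then 0 else if i == 0 then - 'i else 'i
    | PauliZ => if i != j then 0 else if i == 0 then 1 else - 1
    end.

Fixpoint pauli_tensor n : n.-tuple pauli -> 'MC[R]_(2 ^ n) :=
  match n with
  | 0 => fun _ => 1%:M
  | n'.+1 => fun w =>
      castmx (esym (expnS 2 n'), esym (expnS 2 n'))
        (pauli_mx (thead w) *t pauli_tensor [tuple of behead w])
  end.

(* Data of a linear combination of s phased Pauli words, with positive
   coefficients. *)
Record pauli_sum (n s : nat) := PauliSum {
  pauli_coef : 'I_s -> R;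
  pauli_phase : 'I_s -> R[i];
  pauli_word : 'I_s -> n.-tuple pauli;
  pauli_coef_gt0 : forall k, 0 < pauli_coef k;
  pauli_phase_norm : forall k, `|pauli_phase k| = 1
}.

Definition pauli_op n s (P : pauli_sum n s) : 'MC[R]_(2 ^ n) :=
  \sum_k (pauli_coef P k)%:C *:
    (pauli_phase P k *: pauli_tensor (pauli_word P k)).

Definition pauli_norm n s m (PH : pauli_sum n s) (PL : 'I_m -> pauli_sum n s) :
    R :=
  \sum_k pauli_coef PH k + \sum_mu (\sum_k pauli_coef (PL mu) k) ^+ 2.

End Pauli.

Section StochasticSimulation.
Variable R : realType.

Record stoch_sim (d : nat) := StochSim {
  ss_num : nat;
  ss_q : R;
  ss_lambda : 'I_ss_num -> R;
  ss_U : 'I_ss_num -> 'MC[R]_d;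
  ss_state : 'MC[R]_d;
  ss_q_itv : 0 <= ss_q <= 1;
  ss_lambda_itv : forall i, 0 <= ss_lambda i <= 1;
  ss_lambda_sum : \sum_i ss_lambda i = 1;
  ss_U_unitary : forall i, ss_U i \is unitarymx;
  ss_state_density : density ss_state
}.

Variables (d : nat) (S : stoch_sim d).

(* [None] is the index 0 of the fixed state preparation, [Some i] the index of
   the i-th unitary. *)
Definition ss_index : finType := option 'I_(ss_num S).

(* The state preparation rho |-> rho_f is extended linearly from states to
   operators as rho |-> tr(rho) rho_f. *)
Definition oracle (i : ss_index) (rho : 'MC[R]_d) : 'MC[R]_d :=
  match i with
  | None => \tr rho *: ss_state S
  | Some j => ss_U j *m rho *m (ss_U j) ^t*
  end.

Definition oracle_prob (i : ss_index) : R :=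
  match i with
  | None => 1 - ss_q S
  | Some j => ss_q S * ss_lambda j
  end.

Definition ss_channel (rho : 'MC[R]_d) : 'MC[R]_d :=
  \sum_i (oracle_prob i)%:C *: oracle i rho.

(* An algorithm is a list of calls, first call at the head, each one either to
   an oracle whose index is drawn at compilation or to the Hamiltonian
   simulation subroutine. Circuits act on the system alone: no ancilla. *)
Inductive instruction := SampleOracle | CallHamSim.

Definition algorithm := seq instruction.

Inductive gate := OracleGate of ss_index | HamSimGate.

(* The law of the compiled circuit, as a list of weighted circuits; the draws
   of the indices are independent. *)
Fixpoint compile (a : algorithm) : seq (R * seq gate) :=
  match a with
  | [::] => [:: (1, [::])]
  | SampleOracle :: a' =>
      [seq (oracle_prob i * wc.1, OracleGate i :: wc.2)
      | i <- enum ss_index, wc <- compile a']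
  | CallHamSim :: a' => [seq (wc.1, HamSimGate :: wc.2) | wc <- compile a']
  end.

Variable K : 'MC[R]_d -> 'MC[R]_d.

Definition run_gate (rho : 'MC[R]_d) (g : gate) : 'MC[R]_d :=
  match g with
  | OracleGate i => oracle i rho
  | HamSimGate => K rho
  end.

Definition run_circuit (c : seq gate) (rho : 'MC[R]_d) : 'MC[R]_d :=
  foldl run_gate rho c.

Definition averaged_channel (a : algorithm) (rho : 'MC[R]_d) : 'MC[R]_d :=
  \sum_(wc <- compile a) wc.1%:C *: run_circuit wc.2 rho.

End StochasticSimulation.

(* Main.v *)
(** The algorithm is the Strang splitting (K N K)^r. In a Banach algebra,
e^{X} e^{Y} e^{X} and e^{2X+Y} agree up to third order, with an absolute
constant; hence one step errs by O(e_H + (1 + c0) y^3), where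
y = (|H|/2 + |D|) dt is at most 2 |L|_pauli dt. Channels and Lindblad
semigroups being contractions for the diamond norm, the errors of the r steps
add up to O(r e_H + (1 + c0) (|L|_pauli T)^3 / r^2).

Contractivity of e^{tL} is needed when eps is large, where the plain bound
e^{r delta} - 1 on the error of r steps of error delta is not O(eps). It comes
from 1 + sL being within O(s^2) of a map in Kraus form that preserves the trace
up to O(s^2). Trace norms are handled by duality with contractions, and
channels through their Kraus decompositions. *)

Require Import Defs.
From HB Require Import structures.
From mathcomp Require Import all_boot all_order all_algebra.
From mathcomp Require Import complex mxtens.
From mathcomp Require Import all_classical all_reals all_analysis.
From mathcomp Require Import ring lra.

Import Order.TTheory GRing.Theory Num.Theory numFieldNormedType.Exports.

Local Open Scope ring_scope.
Local Open Scope sesquilinear_scope.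

Set Implicit Arguments.
Unset Strict Implicit.
Unset Printing Implicit Defensive.

(** The third-order agreement is checked on polynomials. For a map of norm at most y <= 2 the
    exponential is within y^3/3 of its second-order truncation [taylor2], so only a product of three
    truncations has to be expanded: a finite identity whose remainder is a noncommutative
    polynomial, bounded term by term. Origin of the constants: with Q = |L|_pauli T, one step errs
    by at most 10 e_H + (3 c0 + 20) y^3. Taking e_H <= eps / (20 r) spends eps/2 over the r steps.
    Since y <= 2 Q / r, the remainder adds up to (24 c0 + 160) Q^3 / r^2, which is at most eps/2
    once r^2 >= 400 (1 + 6 c0) Q^3 / eps. This gives the factor 20 in front of the square root and
    the precision factor 1/20; each step makes three calls. *)

(** * Squared lengths, contractions and the singular value decomposition *)

Section TraceNorm.
Variable R : realType.
Local Notation C := R[i].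
Local Notation rc := (real_complex R).

Lemma conj_rc (x : R) : Num.conj (rc x) = rc x.
Proof. exact: conjc_real. Qed.

Lemma ReD (x y : C) : complex.Re (x + y) = complex.Re x + complex.Re y.
Proof. by case: x y => [a b] [c d]. Qed.

Lemma ReN (x : C) : complex.Re (- x) = - complex.Re x.
Proof. by case: x. Qed.

Lemma Re_conj (x : C) : complex.Re (Num.conj x) = complex.Re x.
Proof. by case: x. Qed.

Lemma Re_rcM (a : R) (x : C) : complex.Re (rc a * x) = a * complex.Re x.
Proof. by case: x => b c /=; rewrite mul0r subr0. Qed.

Lemma Re_sum (I : Type) (r : seq I) (P : pred I) (F : I -> C) :
  complex.Re (\sum_(i <- r | P i) F i) = \sum_(i <- r | P i) complex.Re (F i).
Proof. exact: (big_morph _ ReD). Qed.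

Lemma Re_ge0 (x : C) : 0 <= x -> 0 <= complex.Re x.
Proof. by rewrite lecE => /andP[]. Qed.

(** The norm of R[i] takes values in R[i], whose order is partial; this is the modulus as a real
    number, comparable with trace norms. *)
Definition cabs (z : C) : R := complex.Re `|z|.

Lemma cabsE z : `|z| = rc (cabs z).
Proof. by rewrite /cabs normc_def. Qed.

Lemma cabs_ge0 z : 0 <= cabs z.
Proof. exact/Re_ge0/normr_ge0. Qed.

Lemma cabs_eq0 z : (cabs z == 0) = (z == 0).
Proof.
by rewrite -(normr_eq0 z) cabsE -(inj_eq (@complexI R)).
Qed.

Lemma adjM m n p (A : 'M[C]_(m, n)) (B : 'M[C]_(n, p)) :
  (A *m B)^t* = B^t* *m A^t*.
Proof. by rewrite trmx_mul map_mxM. Qed.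

(** Keeping only the real part makes the form symmetric and real valued; when a modulus is wanted, a
    phase is absorbed into a contraction. *)
Definition rip d (u v : 'cV[C]_d) : R := complex.Re ((u^t* *m v) 0 0).
Definition nrm2 d (u : 'cV[C]_d) : R := rip u u.

Lemma ripC d (u v : 'cV[C]_d) : rip u v = rip v u.
Proof.
rewrite /rip -Re_conj; congr complex.Re.
rewrite !mxE rmorph_sum; apply: eq_bigr => i _.
by rewrite !mxE rmorphM /= conjCK mulrC.
Qed.

Lemma ripDr d (u v w : 'cV[C]_d) : rip u (v + w) = rip u v + rip u w.
Proof. by rewrite /rip mulmxDr mxE ReD. Qed.

Lemma ripNr d (u v : 'cV[C]_d) : rip u (- v) = - rip u v.
Proof. by rewrite /rip mulmxN mxE ReN. Qed.

Lemma nrm2_ge0 d (u : 'cV[C]_d) : 0 <= nrm2 u.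
Proof.
rewrite /nrm2 /rip mxE Re_sum sumr_ge0 // => i _; apply: Re_ge0.
by rewrite !mxE mulrC mul_conjC_ge0.
Qed.

Lemma nrm2B d (u v : 'cV[C]_d) : nrm2 (u - v) = nrm2 u + nrm2 v - 2 * rip u v.
Proof.
rewrite /nrm2 ripDr ripNr ![rip (u - v) _]ripC !ripDr !ripNr [rip v u]ripC.
by move: (rip u u) (rip v v) (rip u v) => a b c; ring.
Qed.

Lemma rip_le d (u v : 'cV[C]_d) : 2 * rip u v <= nrm2 u + nrm2 v.
Proof. by rewrite -subr_ge0 -nrm2B nrm2_ge0. Qed.

(** Operator norm at most 1, phrased on squared lengths so that no operator norm has to be
    introduced. *)
Definition contr d (W : 'M[C]_d) := forall u, nrm2 (W *m u) <= nrm2 u.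

Definition rtr d (A : 'M[C]_d) : R := complex.Re (\tr A).

Lemma rtrD d (A B : 'M[C]_d) : rtr (A + B) = rtr A + rtr B.
Proof. by rewrite /rtr mxtraceD ReD. Qed.

Lemma rtrZ d a (A : 'M[C]_d) : rtr (rc a *: A) = a * rtr A.
Proof. by rewrite /rtr mxtraceZ Re_rcM. Qed.

Lemma rtr_sum d (I : Type) (r : seq I) (P : pred I) (F : I -> 'M[C]_d) :
  rtr (\sum_(i <- r | P i) F i) = \sum_(i <- r | P i) rtr (F i).
Proof. by rewrite (big_morph (@rtr d) (@rtrD d) (id1 := 0)) // /rtr mxtrace0. Qed.

Lemma ripE d (u v : 'cV[C]_d) : rip u v = rtr (v *m u^t*).
Proof. by rewrite /rip /rtr mxtrace_mulC trace_mx11. Qed.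

Lemma rip_adj d (W : 'M[C]_d) (u v : 'cV[C]_d) :
  rip u (W *m v) = rip (W^t* *m u) v.
Proof. by rewrite /rip adjM trmxCK mulmxA. Qed.

Lemma nrm2_adj d (W : 'M[C]_d) (u : 'cV[C]_d) :
  nrm2 (W *m u) = rip u (W^t* *m W *m u).
Proof. by rewrite -mulmxA rip_adj trmxCK. Qed.

(** [U] is a partial isometry, so Q = U U^* is an orthogonal projection, and 0 <= |x - Q x|^2 =
    |x|^2 - |U^* x|^2. *)
Lemma proj_contr d (U : 'M[C]_d) :
  U *m (U^t* *m U) = U -> contr (U^t*).
Proof.
move=> UP x; have := nrm2_ge0 (x - U *m U^t* *m x).
rewrite nrm2B nrm2_adj adjM trmxCK.
have -> : U *m U^t* *m (U *m U^t*) = U *m U^t*.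
  by rewrite mulmxA -(mulmxA U) UP.
rewrite nrm2_adj trmxCK; lra.
Qed.

Lemma contrM d (A B : 'M[C]_d) : contr A -> contr B -> contr (A *m B).
Proof. by move=> cA cB u; rewrite -mulmxA; apply: le_trans (cA _) (cB _). Qed.

Lemma unitary_contr d (U : 'M[C]_d) : U \is unitarymx -> contr U.
Proof.
move=> /unitarymxP/mulmx1C UU u.
by rewrite nrm2_adj UU mul1mx.
Qed.

(* [W] is the adjoint of the partial isometry of the polar decomposition, so
   that the trace norm is attained as a trace against a contraction. When
   [s i = 0], the convention [0^-1 = 0] makes [u i] vanish. *)
Lemma svd d (A : 'M[C]_d) :
  exists (s : 'I_d -> R) (u v : 'I_d -> 'cV[C]_d) (W : 'M[C]_d),
  [/\ forall i, [/\ 0 <= s i, nrm2 (u i) <= 1 & nrm2 (v i) <= 1],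
      A = \sum_i rc (s i) *: (u i *m (v i)^t*),
      trace_norm A = \sum_i s i, contr W & rtr (W *m A) = trace_norm A].
Proof.
set B := A^t* *m A.
have Bn : B \is normalmx by apply/normalmxP; rewrite /B adjM trmxCK.
set P := spectralmx B; set sp := spectral_diag B.
have Pu : P \is unitarymx := spectral_unitarymx B.
have PP : P *m P^t* = 1%:M by apply/unitarymxP.
have PP' : P^t* *m P = 1%:M by apply: mulmx1C.
have EB : B = P^t* *m diag_mx sp *m P.
  by move/orthomx_spectralP: (Bn); rewrite -/P -/sp invmx_unitary.
set Z := A *m P^t*.
have ZZ : Z^t* *m Z = diag_mx sp.
  rewrite /Z adjM trmxCK -mulmxA (mulmxA (A^t*)) -/B EB.
  by rewrite !mulmxA PP mul1mx -mulmxA PP mulmx1.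
pose s i : R := Num.sqrt (complex.Re (sp 0 i)).
have spE i : sp 0 i = \sum_k `|Z k i| ^+ 2.
  have /matrixP/(_ i i) := ZZ; rewrite [RHS]mxE eqxx mulr1n => <-.
  by rewrite mxE; apply: eq_bigr => k _; rewrite !mxE normCK mulrC.
have sp0 i : 0 <= sp 0 i by rewrite spE sumr_ge0 // => k _; rewrite exprn_ge0.
have sps i : sp 0 i = rc (s i) * rc (s i).
  rewrite -rmorphM /= -expr2 sqr_sqrtr; last exact: Re_ge0.
  by rewrite RRe_real // ger0_real.
have s0 i : 0 <= s i by apply: sqrtr_ge0.
pose t : 'rV[C]_d := \row_i (rc (s i))^-1.
pose T := diag_mx t.
have TT : T^t* = T.
  rewrite /T tr_diag_mx map_diag_mx; congr diag_mx.
  by apply/rowP => i; rewrite !mxE fmorphV /= conj_rc.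
pose U := Z *m T.
have UU : U^t* *m U = diag_mx (\row_i (s i != 0)%:R).
  rewrite /U adjM TT -mulmxA (mulmxA _ Z) ZZ !mulmx_diag; congr diag_mx.
  apply/rowP => i; rewrite !mxE sps.
  have [->|h] := eqVneq (s i) 0; first by rewrite invr0 mul0r.
  have h' : rc (s i) != 0 by rewrite fmorph_eq0.
  by rewrite mulfK // mulVf.
have UP : U *m (U^t* *m U) = U.
  rewrite UU /U -mulmxA mulmx_diag; congr (_ *m diag_mx _).
  apply/rowP => i; rewrite !mxE.
  by have [->|h] := eqVneq (s i) 0; rewrite ?invr0 ?mulr1 ?mul0r.
have US : U *m diag_mx (\row_i rc (s i)) = Z.
  rewrite /U -mulmxA mulmx_diag.
  apply/matrixP => k i; rewrite mul_mx_diag !mxE.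
  have [si0|h] := eqVneq (s i) 0; last by rewrite mulVf ?mulr1 // fmorph_eq0.
  (* A zero eigenvalue is the sum of the squared moduli of a column of [Z], so that this column
     vanishes as well. *)
  have /eqP := spE i; rewrite sps si0 mul0r eq_sym psumr_eq0; last first.
    by move=> j _; rewrite exprn_ge0.
  move=> /allP /(_ k); rewrite mem_index_enum => /(_ isT) /=.
  by rewrite expf_eq0 normr_eq0 /= mxE => /eqP ->; rewrite mul0r.
have ZP : Z *m P = A by rewrite /Z -mulmxA PP' mulmx1.
have tnE : trace_norm A = \sum_i s i by [].
have trE : rtr (P^t* *m U^t* *m A) = trace_norm A.
  rewrite tnE /rtr -ZP -mulmxA mxtrace_mulC -!mulmxA PP mulmx1.
  rewrite /U adjM TT -mulmxA ZZ mulmx_diag mxtrace_diag Re_sum.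
  apply: eq_bigr => i _; rewrite !mxE sps.
  have [->|h] := eqVneq (s i) 0; first by rewrite !mulr0.
  by rewrite mulKf // fmorph_eq0.
exists s, (fun i => col i U), (fun i => col i (P^t*)), (P^t* *m U^t*); split => //.
- move=> i; split => //.
    rewrite /nrm2 /rip.
    have -> : ((col i U)^t* *m col i U) 0 0 = (U^t* *m U) i i.
      by rewrite !mxE; apply: eq_bigr => k _; rewrite !mxE.
    rewrite UU !mxE eqxx mulr1n; case: (_ != _) => //=; exact: ler01.
  rewrite /nrm2 /rip.
  have -> : ((col i (P^t*))^t* *m col i (P^t*)) 0 0 = (P *m P^t*) i i.
    rewrite !mxE; apply: eq_bigr => k _; rewrite !mxE.
    by rewrite conjCK.
  by rewrite PP !mxE eqxx.
- rewrite -{1}ZP -US -mulmxA; apply/matrixP => a b.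
  rewrite summxE mxE; apply: eq_bigr => i _.
  rewrite mul_diag_mx !mxE big_ord1 !mxE conjCK; ring.
- apply: contrM; last exact: proj_contr.
  by apply: unitary_contr; rewrite trmxC_unitary.
Qed.
End TraceNorm.

(** * The trace norm, by duality with contractions *)

Section TraceNormTheory.
Variable R : realType.
Local Notation C := R[i].
Local Notation rc := (real_complex R).

Lemma nrm2Z d (z : C) (u : 'cV[C]_d) : nrm2 (z *: u) = cabs z ^+ 2 * nrm2 u.
Proof.
rewrite /nrm2 /rip.
have -> : ((z *: u)^t* *m (z *: u)) 0 0 = rc (cabs z ^+ 2) * (u^t* *m u) 0 0.
  rewrite !mxE mulr_sumr; apply: eq_bigr => i _; rewrite !mxE rmorphM /=.
  by rewrite rmorphXn /= -cabsE normCK; ring.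
by rewrite Re_rcM.
Qed.

Lemma tn_ge0 d (A : 'M[C]_d) : 0 <= trace_norm A.
Proof. by apply: sumr_ge0 => i _; exact: sqrtr_ge0. Qed.

(** Each singular term contributes s_i Re <v_i, W u_i>, and 2 Re <v_i, W u_i> <= |v_i|^2 + |W u_i|^2
    <= 2. *)
Lemma rtr_le_tn d (W A : 'M[C]_d) : contr W -> rtr (W *m A) <= trace_norm A.
Proof.
move=> cW; have [s [u [v [_ [suv EA -> _ _]]]]] := svd A.
rewrite {1}EA mulmx_sumr rtr_sum; apply: ler_sum => i _.
have [s0 u1 v1] := suv i.
rewrite -scalemxAr rtrZ mulmxA -ripE -[leRHS]mulr1 ler_wpM2l //.
have := rip_le (v i) (W *m u i); have := cW (u i).
move: (nrm2 (W *m u i)) (rip (v i) (W *m u i)) => a b; lra.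
Qed.

Lemma tnP d (A : 'M[C]_d) : exists2 W, contr W & rtr (W *m A) = trace_norm A.
Proof. by have [s [u [v [W [_ _ _ cW WA]]]]] := svd A; exists W. Qed.

(** Since the dual maximum is attained, norm inequalities such as the triangle inequality reduce to
    linear estimates against one fixed contraction. *)
Lemma tn_bound d (A : 'M[C]_d) c :
  (forall W, contr W -> rtr (W *m A) <= c) -> trace_norm A <= c.
Proof. by move=> h; have [W cW <-] := tnP A; exact: h. Qed.

Lemma tn0 d : trace_norm (0 : 'M[C]_d) = 0.
Proof.
by have [W _ <-] := tnP (0 : 'M[C]_d); rewrite mulmx0 /rtr mxtrace0.
Qed.

Lemma tnD d (A B : 'M[C]_d) : trace_norm (A + B) <= trace_norm A + trace_norm B.
Proof.
by apply: tn_bound => W cW; rewrite mulmxDr rtrD lerD ?rtr_le_tn.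
Qed.

Lemma contrZ d (z : C) (W : 'M[C]_d) : cabs z <= 1 -> contr W -> contr (z *: W).
Proof.
move=> z1 cW u; rewrite -scalemxAl nrm2Z; apply: le_trans (cW u).
by rewrite ler_piMl ?nrm2_ge0 // expr_le1 ?cabs_ge0.
Qed.

Lemma contr1 d : contr (1%:M : 'M[C]_d).
Proof. by move=> u; rewrite mul1mx. Qed.

Lemma cabs_phase (z : C) : exists2 f : C, cabs f = 1 & z = rc (cabs z) * f.
Proof.
have [->|z0] := eqVneq z 0.
  by exists 1; rewrite /cabs ?normr1 ?normr0 //= mul0r.
have h : rc (cabs z) != 0 by rewrite fmorph_eq0 cabs_eq0.
exists (z / rc (cabs z)); last by rewrite mulrC divfK.
by rewrite {1}/cabs normrM normfV -cabsE normr_id divff // normr_eq0.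
Qed.

Lemma tnZ d (z : C) (A : 'M[C]_d) : trace_norm (z *: A) <= cabs z * trace_norm A.
Proof.
have [f f1 {1}->] := cabs_phase z; apply: tn_bound => W cW.
rewrite -scalerA -scalemxAr rtrZ ler_wpM2l ?cabs_ge0 // -scalemxAr scalemxAl.
by apply/rtr_le_tn/contrZ => //; rewrite f1.
Qed.

Lemma cabs_rc (a : R) : cabs (rc a) = `|a|.
Proof. by rewrite /cabs normc_def /= expr0n addr0 sqrtr_sqr. Qed.

Lemma tnZr d (a : R) (A : 'M[C]_d) : trace_norm (rc a *: A) <= `|a| * trace_norm A.
Proof. by rewrite -cabs_rc; exact: tnZ. Qed.

Lemma tnN d (A : 'M[C]_d) : trace_norm (- A) = trace_norm A.
Proof.
have h B : trace_norm (- B : 'M[C]_d) <= trace_norm B.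
  by rewrite -scaleN1r; apply: le_trans (tnZ _ _) _; rewrite /cabs normrN1 mul1r.
by apply/eqP; rewrite eq_le h -{1}[A]opprK h.
Qed.

Lemma tnB d (A B : 'M[C]_d) : trace_norm (A - B) <= trace_norm A + trace_norm B.
Proof. by rewrite -(tnN B); exact: tnD. Qed.

Lemma tn_sum d (I : Type) (r : seq I) (P : pred I) (F : I -> 'M[C]_d) :
  trace_norm (\sum_(i <- r | P i) F i) <= \sum_(i <- r | P i) trace_norm (F i).
Proof.
apply: (big_ind2 (fun x y => trace_norm x <= y)) => //; first by rewrite tn0.
by move=> A a B b ha hb; apply: le_trans (tnD _ _) (lerD ha hb).
Qed.

(** The arithmetic mean of the squared lengths replaces |u| |v|, which spares square roots; for unit
    vectors both equal 1. *)
Lemma tn_rank1 d (u v : 'cV[C]_d) :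
  2 * trace_norm (u *m v^t*) <= nrm2 u + nrm2 v.
Proof.
rewrite mulrC -ler_pdivlMr //; apply: tn_bound => W cW.
rewrite mulmxA -ripE ler_pdivlMr // mulrC.
by apply: le_trans (rip_le _ _) _; rewrite addrC lerD2r.
Qed.

Lemma nrm2E d (u : 'cV[C]_d) : nrm2 u = \sum_i cabs (u i 0) ^+ 2.
Proof.
rewrite /nrm2 /rip mxE Re_sum; apply: eq_bigr => i _.
by rewrite !mxE mulrC -normCK cabsE -rmorphXn.
Qed.

Lemma nrm2_delta d (i : 'I_d) : nrm2 (delta_mx i 0 : 'cV[C]_d) = 1.
Proof.
rewrite nrm2E (bigD1 i) //= big1 ?addr0 => [|j ji].
  by rewrite mxE !eqxx /cabs normr1 expr1n.
by rewrite mxE (negbTE ji) /cabs normr0 expr0n.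
Qed.

Lemma adj_delta m n (i : 'I_m) (j : 'I_n) :
  (delta_mx i j : 'M[C]_(m, n))^t* = delta_mx j i.
Proof. by rewrite trmx_delta; apply/matrixP => a b; rewrite !mxE conjC_nat. Qed.

Lemma delta_rank1 m n (i : 'I_m) (j : 'I_n) :
  delta_mx i j = (delta_mx i 0 : 'cV[C]_m) *m (delta_mx j 0 : 'cV[C]_n)^t*.
Proof. by rewrite adj_delta mul_delta_mx. Qed.

Lemma tn_delta d (i j : 'I_d) : trace_norm (delta_mx i j : 'M[C]_d) <= 1.
Proof.
rewrite delta_rank1.
have := tn_rank1 (delta_mx i 0 : 'cV[C]_d) (delta_mx j 0).
rewrite !nrm2_delta; lra.
Qed.

Lemma contr_delta d (i j : 'I_d) : contr (delta_mx i j : 'M[C]_d).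
Proof.
move=> u.
have -> : delta_mx i j *m u = u j 0 *: delta_mx i 0.
  rewrite -{1}(mul_delta_mx (0 : 'I_1)) -mulmxA -rowE.
  have -> : row j u = (u j 0)%:M.
    by apply/matrixP => a b; rewrite !ord1 !mxE eqxx mulr1n.
  by rewrite mul_mx_scalar.
rewrite nrm2Z nrm2_delta mulr1 nrm2E (bigD1 j) //= lerDl.
by apply: sumr_ge0 => k _; rewrite sqr_ge0.
Qed.

(** The entry is the trace of [A] against a matrix unit, which is a contraction; a phase factor on
    that unit makes the trace equal to the modulus. *)
Lemma entry_le_tn d (A : 'M[C]_d) i j : cabs (A i j) <= trace_norm A.
Proof.
have [f f1 EA] := cabs_phase (A i j).
have f1' : cabs (Num.conj f) = 1 by rewrite /cabs norm_conjC.
have <- : rtr ((Num.conj f *: delta_mx j i) *m A) = cabs (A i j).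
  rewrite /rtr -scalemxAl mxtraceZ -(mul_delta_mx (0 : 'I_1)) -mulmxA.
  rewrite mxtrace_mulC -mulmxA -rowE -colE trace_mx11 !mxE {1}EA mulrCA.
  by rewrite -normCKC (cabsE f) f1 expr1n mulr1.
by apply/rtr_le_tn/contrZ; [rewrite f1' | exact: contr_delta].
Qed.

Lemma tn_le_entries d (A : 'M[C]_d) :
  trace_norm A <= \sum_i \sum_j cabs (A i j).
Proof.
rewrite [A in trace_norm A]matrix_sum_delta; apply: le_trans (tn_sum _ _ _) _.
apply: ler_sum => i _; apply: le_trans (tn_sum _ _ _) _.
apply: ler_sum => j _; apply: le_trans (tnZ _ _) _.
by rewrite -[leRHS]mulr1 ler_wpM2l ?cabs_ge0 ?tn_delta.
Qed.

Lemma tn_eq0 d (A : 'M[C]_d) : trace_norm A = 0 -> A = 0.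
Proof.
move=> h; apply/matrixP => i j; rewrite mxE; apply/eqP.
by rewrite -cabs_eq0 eq_le cabs_ge0 -h entry_le_tn.
Qed.

(** The constant depends on the dimension and is crude. It serves only where its size does not
    matter: boundedness of a supremum, convergence of series, and limits of fine subdivisions. *)
Lemma linear_tn_bounded d d' (F : 'M[C]_d -> 'M[C]_d') : linear F ->
  exists2 c, 0 <= c & forall X, trace_norm (F X) <= c * trace_norm X.
Proof.
move=> lF.
pose f : {linear 'M[C]_d -> 'M[C]_d'} :=
  HB.pack F (GRing.isLinear.Build _ _ _ _ F lF).
exists (\sum_i \sum_j trace_norm (F (delta_mx i j))).
  by do 2!(apply: sumr_ge0 => ? _); exact: tn_ge0.
move=> X; rewrite {1}[X]matrix_sum_delta -[F]/(f : _ -> _) linear_sum.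
rewrite mulr_suml; apply: le_trans (tn_sum _ _ _) _; apply: ler_sum => i _.
rewrite linear_sum mulr_suml; apply: le_trans (tn_sum _ _ _) _.
apply: ler_sum => j _; rewrite linearZ; apply: le_trans (tnZ _ _) _.
by rewrite mulrC ler_wpM2l ?tn_ge0 ?entry_le_tn.
Qed.

(** The singular values weigh rank-one operators built on vectors of length at most 1, and their sum
    is the trace norm. *)
Lemma tn_rank1_reduction d d' (F : 'M[C]_d -> 'M[C]_d') c : linear F ->
  (forall u v, nrm2 u <= 1 -> nrm2 v <= 1 -> trace_norm (F (u *m v^t*)) <= c) ->
  forall X, trace_norm (F X) <= c * trace_norm X.
Proof.
move=> lF Fc X; have [s [u [v [_ [suv EX -> _ _]]]]] := svd X.
pose f : {linear 'M[C]_d -> 'M[C]_d'} :=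
  HB.pack F (GRing.isLinear.Build _ _ _ _ F lF).
rewrite {1}EX -[F]/(f : _ -> _) linear_sum mulr_sumr.
apply: le_trans (tn_sum _ _ _) _; apply: ler_sum => i _.
have [s0 u1 v1] := suv i; rewrite linearZ /=.
apply: le_trans (tnZr _ _) _; rewrite ger0_norm // mulrC ler_wpM2r //.
exact: Fc.
Qed.

End TraceNormTheory.

Local Opaque trace_norm.

(** * Bounds on I (x) M and their relation to the diamond norm *)

Section DiamondNorm.
Variable R : realType.
Local Notation C := R[i].
Local Notation rc := (real_complex R).

(** Since [tens_id M] acts as [M] on each block, this reduces the algebra of [tens_id] to that of
    [M]. *)
Lemma tens_blockP d (A B : 'M[C]_(d * d)) :
  (forall i j, tens_block A i j = tens_block B i j) -> A = B.
Proof.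
move=> h; apply/matrixP => x y.
case: (mxtens_indexP x) => i a; case: (mxtens_indexP y) => j b.
by have /matrixP/(_ a b) := h i j; rewrite !mxE.
Qed.

Lemma tens_block_tens_id d (M : 'M[C]_d -> 'M[C]_d) (X : 'M[C]_(d * d)) i j :
  tens_block (tens_id M X) i j = M (tens_block X i j).
Proof.
apply/matrixP => a b; rewrite mxE /tens_id summxE (bigD1 i) //=.
rewrite summxE (bigD1 j) //= tensmxE mxE !eqxx mul1r.
rewrite !big1 ?addr0 // => [k ki|k kj].
  rewrite summxE big1 // => l _; rewrite tensmxE mxE.
  by rewrite eq_sym (negbTE ki) mul0r.
by rewrite tensmxE mxE [j == k]eq_sym (negbTE kj) andbF mul0r.
Qed.

Lemma tens_blockD d (X Y : 'M[C]_(d * d)) (i j : 'I_d) :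
  tens_block (X + Y) i j = tens_block X i j + tens_block Y i j.
Proof. by apply/matrixP => a b; rewrite !mxE. Qed.

Lemma tens_blockZ d z (X : 'M[C]_(d * d)) (i j : 'I_d) :
  tens_block (z *: X) i j = z *: tens_block X i j.
Proof. by apply/matrixP => a b; rewrite !mxE. Qed.

Lemma tens_id_linear d (M : 'M[C]_d -> 'M[C]_d) :
  linear M -> linear (tens_id (k := d) M).
Proof.
move=> lM z X Y; apply: tens_blockP => i j.
by rewrite !(tens_blockD, tens_blockZ, tens_block_tens_id) lM.
Qed.

Lemma eq_tens_id d (M N : 'M[C]_d -> 'M[C]_d) (X : 'M[C]_(d * d)) :
  M =1 N -> tens_id M X = tens_id N X.
Proof. by move=> h; apply: tens_blockP => i j; rewrite !tens_block_tens_id h. Qed.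

Lemma tens_id_comp d (M N : 'M[C]_d -> 'M[C]_d) (X : 'M[C]_(d * d)) :
  tens_id (M \o N) X = tens_id M (tens_id N X).
Proof. by apply: tens_blockP => i j; rewrite !tens_block_tens_id. Qed.

Lemma tens_idD d (M N : 'M[C]_d -> 'M[C]_d) (X : 'M[C]_(d * d)) :
  tens_id (M \+ N) X = tens_id M X + tens_id N X.
Proof.
by apply: tens_blockP => i j; rewrite !(tens_blockD, tens_block_tens_id).
Qed.

Lemma tens_idZ d z (M : 'M[C]_d -> 'M[C]_d) (X : 'M[C]_(d * d)) :
  tens_id (fun A => z *: M A) X = z *: tens_id M X.
Proof.
by apply: tens_blockP => i j; rewrite !(tens_blockZ, tens_block_tens_id).
Qed.

(* Bounds are stated through this predicate rather than through [diamond_norm],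
   whose supremum is the junk value 0 on unbounded sets: no linearity is then
   needed for the closure properties. *)
Definition dbound d (M : 'M[C]_d -> 'M[C]_d) (c : R) :=
  forall X : 'M[C]_(d * d), trace_norm (tens_id M X) <= c * trace_norm X.

Lemma eq_dbound d (M N : 'M[C]_d -> 'M[C]_d) c :
  M =1 N -> dbound N c -> dbound M c.
Proof. by move=> MN h X; rewrite (eq_tens_id _ MN). Qed.

Lemma dbound_le d (M : 'M[C]_d -> 'M[C]_d) a b :
  a <= b -> dbound M a -> dbound M b.
Proof. by move=> ab h X; apply: le_trans (h X) _; rewrite ler_wpM2r ?tn_ge0. Qed.

Lemma dboundD d (M N : 'M[C]_d -> 'M[C]_d) a b :
  dbound M a -> dbound N b -> dbound (M \+ N) (a + b).
Proof.
by move=> hM hN X; rewrite tens_idD mulrDl; apply: le_trans (tnD _ _) (lerD _ _).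
Qed.

Lemma dboundZ d (M : 'M[C]_d -> 'M[C]_d) a z :
  dbound M a -> dbound (fun A => z *: M A) (cabs z * a).
Proof.
move=> hM X; rewrite tens_idZ -mulrA; apply: le_trans (tnZ _ _) _.
by rewrite ler_wpM2l ?cabs_ge0.
Qed.

Lemma dboundZr d (M : 'M[C]_d -> 'M[C]_d) a b : 0 <= a ->
  dbound M b -> dbound (fun A => rc a *: M A) (a * b).
Proof. by move=> a0 /(@dboundZ _ _ _ (rc a)); rewrite cabs_rc ger0_norm. Qed.

Lemma dboundB d (M N : 'M[C]_d -> 'M[C]_d) a b :
  dbound M a -> dbound N b -> dbound (M \- N) (a + b).
Proof.
move=> hM hN; have hN' := dboundZ (-1) hN; rewrite /cabs normrN1 mul1r in hN'.
apply: eq_dbound _ (dboundD hM hN') => X /=.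
by rewrite scaleN1r.
Qed.

Lemma dbound_comp d (M N : 'M[C]_d -> 'M[C]_d) a b :
  0 <= a -> dbound M a -> dbound N b -> dbound (M \o N) (a * b).
Proof.
move=> a0 hM hN X; rewrite tens_id_comp -mulrA.
by apply: le_trans (hM _) _; rewrite ler_wpM2l.
Qed.

Lemma dbound_id d : dbound (@id 'M[C]_d) 1.
Proof.
move=> X; rewrite mul1r (_ : tens_id _ _ = X) //.
by apply: tens_blockP => i j; rewrite tens_block_tens_id.
Qed.

Lemma dbound0 d : dbound (fun _ : 'M[C]_d => 0) 0.
Proof.
move=> X; rewrite mul0r (_ : tens_id _ _ = 0) ?tn0 //.
by apply: tens_blockP => i j; rewrite tens_block_tens_id; apply/matrixP=> a b; rewrite !mxE.
Qed.

Lemma dbound_sum d (I : Type) (r : seq I) (P : pred I)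
    (F : I -> 'M[C]_d -> 'M[C]_d) (c : I -> R) :
  (forall i, P i -> dbound (F i) (c i)) ->
  dbound (fun X => \sum_(i <- r | P i) F i X) (\sum_(i <- r | P i) c i).
Proof.
move=> h; elim: r => [|i r IH].
  by rewrite big_nil; apply: eq_dbound _ (@dbound0 d) => X; rewrite big_nil.
rewrite big_cons; case: ifP => Pi; last first.
  by apply: eq_dbound _ IH => X; rewrite big_cons Pi.
apply: eq_dbound _ (dboundD (h i Pi) IH) => X.
by rewrite big_cons Pi.
Qed.

Lemma linear_dbound d (M : 'M[C]_d -> 'M[C]_d) :
  linear M -> exists2 c, 0 <= c & dbound M c.
Proof. by move=> /tens_id_linear/linear_tn_bounded. Qed.

Lemma tnZr_eq d (a : R) (A : 'M[C]_d) :
  trace_norm (rc a *: A) = `|a| * trace_norm A.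
Proof.
apply/eqP; rewrite eq_le tnZr /=; have [->|a0] := eqVneq a 0.
  by rewrite normr0 mul0r tn_ge0.
have := tnZr a^-1 (rc a *: A).
rewrite scalerA -rmorphM mulVf // rmorph1 scale1r normfV.
by rewrite ler_pdivlMl // normr_gt0.
Qed.

Lemma tn_normalize d (A : 'M[C]_d) : 0 < trace_norm A ->
  trace_norm (rc (trace_norm A)^-1 *: A) = 1.
Proof.
by move=> t0; rewrite tnZr_eq gtr0_norm ?invr_gt0 // mulVf // gt_eqF.
Qed.

Lemma tn_delta_gt0 d (i : 'I_d) : 0 < trace_norm (delta_mx i i : 'M[C]_d).
Proof.
apply: lt_le_trans (entry_le_tn _ i i).
by rewrite mxE !eqxx /cabs normr1 ltr01.
Qed.

Lemma dbound_diamond d (M : 'M[C]_d -> 'M[C]_d) c :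
  (0 < d)%N -> dbound M c -> diamond_norm M <= c.
Proof.
move=> d0 h; apply: ge_sup; last first.
  by move=> _ /= [X X1 <-]; rewrite -[leRHS]mulr1 -X1.
(* The bound on the supremum asks for an inhabited set; a normalised matrix unit is an element, and
   exists because 0 < d. *)
have dd0 : (0 < d * d)%N by rewrite muln_gt0 d0.
have Y1 := tn_normalize (tn_delta_gt0 (Ordinal dd0)).
by set Y := (_ *: _) in Y1; exists (trace_norm (tens_id (k := d) M Y)), Y.
Qed.

Lemma diamond_dbound d (M : 'M[C]_d -> 'M[C]_d) :
  linear M -> dbound M (diamond_norm M).
Proof.
move=> lM X; have [X0|X0] := eqVneq (trace_norm X) 0.
  have lT := tens_id_linear lM.
  have -> : X = 0 by apply: tn_eq0.
  have [c _ /(_ 0)] := linear_tn_bounded lT.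
  by rewrite tn0 !mulr0.
have t0 : 0 < trace_norm X by rewrite lt_def X0 tn_ge0.
pose Y : 'M[C]_(d * d) := rc (trace_norm X)^-1 *: X.
have XY : X = rc (trace_norm X) *: Y.
  by rewrite scalerA -rmorphM mulfV // rmorph1 scale1r.
have Y1 : trace_norm Y = 1 := tn_normalize t0.
have -> : tens_id M X = rc (trace_norm X) *: tens_id M Y.
  have := tens_id_linear lM (rc (trace_norm X)) Y 0.
  rewrite addr0 -XY => ->; rewrite (_ : tens_id M 0 = 0) ?addr0 //.
  apply: tn_eq0; have [c _ /(_ 0)] := linear_tn_bounded (tens_id_linear lM).
  by rewrite tn0 mulr0 => h; apply/eqP; rewrite eq_le h tn_ge0.
apply: le_trans (tnZr _ _) _.
rewrite ger0_norm ?tn_ge0 // mulrC ler_wpM2r ?tn_ge0 //.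
apply: ub_le_sup; last by exists Y.
have [c c0 hc] := linear_dbound lM.
by exists c => _ /= [Z Z1 <-]; rewrite -[leRHS]mulr1 -Z1.
Qed.

Lemma diamond_ge0 d (M : 'M[C]_d -> 'M[C]_d) :
  (0 < d)%N -> linear M -> 0 <= diamond_norm M.
Proof.
move=> d0 lM; have dd0 : (0 < d * d)%N by rewrite muln_gt0 d0.
have t0 := tn_delta_gt0 (Ordinal dd0).
rewrite -(pmulr_lge0 _ t0); apply: le_trans (diamond_dbound lM _).
exact: tn_ge0.
Qed.

Lemma sum_mxtens d (V : nmodType) (F : 'I_(d * d) -> V) :
  \sum_k F k = \sum_i \sum_j F (mxtens_index (i, j)).
Proof.
rewrite pair_big /= (reindex (@mxtens_index d d)) /=.
  by apply: eq_bigr => -[i j].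
exists (@mxtens_unindex d d) => ? _; [exact: mxtens_indexK | exact: mxtens_unindexK].
Qed.

Lemma tens_blockM d (A B : 'M[C]_d) (X : 'M[C]_(d * d)) (i j : 'I_d) :
  tens_block ((1%:M *t A) *m X *m (1%:M *t B)) i j =
  A *m tens_block X i j *m B.
Proof.
apply/matrixP => a b; rewrite !mxE sum_mxtens (bigD1 j) //= [X in _ + X]big1.
  rewrite addr0; apply: eq_bigr => c _.
  rewrite tensmxE [1%:M j j]mxE eqxx mul1r; congr (_ * _).
  rewrite !mxE sum_mxtens (bigD1 i) //= [X in _ + X]big1 ?addr0.
    by apply: eq_bigr => e _; rewrite tensmxE !mxE eqxx mul1r.
  move=> k ki; apply: big1 => e _.
  by rewrite tensmxE mxE eq_sym (negbTE ki) !mul0r.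
move=> k kj; apply: big1 => e _.
by rewrite tensmxE [1%:M k j]mxE (negbTE kj) mul0r mulr0.
Qed.

Lemma tens_id_mul d (A B : 'M[C]_d) (X : 'M[C]_(d * d)) :
  tens_id (fun Y => A *m Y *m B) X = (1%:M *t A) *m X *m (1%:M *t B).
Proof.
by apply: tens_blockP => i j; rewrite tens_blockM tens_block_tens_id.
Qed.

Lemma adj_tens m n (A : 'M[C]_m) (B : 'M[C]_n) : (A *t B)^t* = A^t* *t B^t*.
Proof. by rewrite trmx_tens map_mxT. Qed.

Lemma adj1 n : (1%:M : 'M[C]_n)^t* = 1%:M.
Proof. by rewrite trmx1 map_mx1. Qed.

Definition colblock d (u : 'cV[C]_(d * d)) (i : 'I_d) : 'cV[C]_d :=
  \col_a u (mxtens_index (i, a)) 0.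

Lemma nrm2_colblock d (u : 'cV[C]_(d * d)) :
  nrm2 u = \sum_i nrm2 (colblock u i).
Proof.
rewrite nrm2E sum_mxtens; apply: eq_bigr => i _.
by rewrite nrm2E; apply: eq_bigr => a _; rewrite mxE.
Qed.

Lemma colblock_mul d (A : 'M[C]_d) (u : 'cV[C]_(d * d)) i :
  colblock ((1%:M *t A) *m u) i = A *m colblock u i.
Proof.
apply/matrixP => a b; rewrite !mxE sum_mxtens (bigD1 i) //= [X in _ + X]big1.
  by rewrite addr0; apply: eq_bigr => c _; rewrite tensmxE !mxE eqxx mul1r.
move=> k ki; apply: big1 => e _.
by rewrite tensmxE mxE eq_sym (negbTE ki) !mul0r.
Qed.

Lemma tens_id_rank1 d (A B : 'M[C]_d) (u v : 'cV[C]_(d * d)) :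
  tens_id (fun Y => A *m Y *m B^t*) (u *m v^t*) =
  ((1%:M *t A) *m u) *m ((1%:M *t B) *m v)^t*.
Proof. by rewrite tens_id_mul adjM adj_tens adj1 !mulmxA. Qed.

Lemma kraus_linear d (I : finType) (K : I -> 'M[C]_d) :
  linear (fun X => \sum_a K a *m X *m (K a)^t*).
Proof.
move=> z X Y; rewrite scaler_sumr -big_split /=; apply: eq_bigr => a _.
by rewrite mulmxDr mulmxDl -scalemxAr -scalemxAl.
Qed.

(* By the singular value decomposition it suffices to treat u v^*, for which
   each Kraus term contributes at most |K u| |K v| <= (|K u|^2 + |K v|^2) / 2. *)
Lemma dbound_kraus d (I : finType) (K : I -> 'M[C]_d) s : 0 <= s ->
  (forall u, \sum_a nrm2 (K a *m u) <= s * nrm2 u) ->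
  dbound (fun X => \sum_a K a *m X *m (K a)^t*) s.
Proof.
move=> s0 hK; apply: tn_rank1_reduction => [|u v u1 v1].
  exact/tens_id_linear/kraus_linear.
have -> : tens_id (fun X => \sum_a K a *m X *m (K a)^t*) (u *m v^t*) =
    \sum_a (((1%:M : 'M[C]_d) *t K a) *m u) *m (((1%:M : 'M[C]_d) *t K a) *m v)^t*.
  under eq_bigr do rewrite -tens_id_rank1.
  apply: tens_blockP => i j; rewrite tens_block_tens_id.
  rewrite (big_morph (fun X => tens_block X i j) (id1 := 0) (op1 := +%R)); last first.
  - by apply/matrixP => a b; rewrite !mxE.
  - by move=> X Y; rewrite tens_blockD.
  by apply: eq_bigr => a _; rewrite tens_block_tens_id.
have hK' w : \sum_a nrm2 (((1%:M : 'M[C]_d) *t K a) *m w) <= s * nrm2 w.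
  rewrite (nrm2_colblock w) mulr_sumr.
  under eq_bigr do rewrite nrm2_colblock.
  rewrite exchange_big /=; apply: ler_sum => i _.
  by under eq_bigr do rewrite colblock_mul; exact: hK.
apply: le_trans (tn_sum _ _ _) _; rewrite -(ler_pM2l (ltr0Sn R 1)) mulr_sumr.
apply: (@le_trans _ _ (\sum_a (nrm2 (((1%:M : 'M[C]_d) *t K a) *m u) +
                               nrm2 (((1%:M : 'M[C]_d) *t K a) *m v)))).
  by apply: ler_sum => a _; exact: tn_rank1.
have := hK' u; have := hK' v; rewrite big_split /=.
have := ler_wpM2l s0 u1; have := ler_wpM2l s0 v1; lra.
Qed.

(** The Kraus bound has the same operator on both sides; the cross terms of a product of two Pauli
    expansions call for different ones. *)
Lemma dbound_contr2 d (A B : 'M[C]_d) : contr A -> contr B ->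
  dbound (fun X => A *m X *m B^t*) 1.
Proof.
move=> cA cB; apply: tn_rank1_reduction => [|u v u1 v1].
  apply: tens_id_linear => z X Y.
  by rewrite mulmxDr mulmxDl -scalemxAr -scalemxAl.
rewrite tens_id_rank1 -(ler_pM2l (ltr0Sn R 1)); apply: le_trans (tn_rank1 _ _) _.
have h (W : 'M[C]_d) (w : 'cV[C]_(d * d)) :
    contr W -> nrm2 (((1%:M : 'M[C]_d) *t W) *m w) <= nrm2 w.
  move=> cW; rewrite nrm2_colblock (nrm2_colblock w); apply: ler_sum => i _.
  by rewrite colblock_mul.
have := h _ u cA; have := h _ v cB; lra.
Qed.

End DiamondNorm.

Local Opaque diamond_norm.

(** * Positive matrices, Kraus decompositions and contractivity of channels *)

Section Channels.
Variable R : realType.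
Local Notation C := R[i].
Local Notation rc := (real_complex R).

(** Polarisation: the quadratic form is real on every vector, and its reality at e_i, e_j, e_i + e_j
    and e_i + i e_j forces the entries (i, j) and (j, i) to be conjugate. *)
Lemma psdmx_herm d (A : 'M[C]_d) : psdmx A -> A^t* = A.
Proof.
move=> pA; apply/matrixP => i j; rewrite !mxE.
have q (z : C) k l : complex.Im (A k k + Num.conj z * A k l + z * A l k
    + z * Num.conj z * A l l) = 0.
  have /ger0_Im := pA (delta_mx 0 k + z *: delta_mx 0 l).
  rewrite raddfD /= map_mxD linearZ /= map_mxZ !adj_delta.
  rewrite !mulmxDl !mulmxDr -!scalemxAl -!scalemxAr -!rowE -!colE !mxE => <-.
  congr complex.Im; ring.
have := q 0 i i; have := q 0 j j; have := q 1 i j.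
have := q ('i)%C i j; have := q 1 i i.
rewrite !rmorph1 -[Num.conj ('i)%C]/(0 -i* 1)%C.
case: (A i i) (A j j) (A i j) (A j i) => [a a'] [b b'] [c c'] [e e'] /=.
move=> h1 h2 h3 h4 h5; apply/eqP; rewrite eq_complex /=.
by apply/andP; split; apply/eqP; lra.
Qed.

Lemma psdmx_decomp d (A : 'M[C]_d) : psdmx A ->
  exists w : 'I_d -> 'cV[C]_d, A = \sum_a w a *m (w a)^t*.
Proof.
move=> pA; have hA := psdmx_herm pA.
have An : A \is normalmx by apply/normalmxP; rewrite hA.
set P := spectralmx A; set sp := spectral_diag A.
have Pu : P \is unitarymx := spectral_unitarymx A.
have PP : P *m P^t* = 1%:M by apply/unitarymxP.
have EA : A = P^t* *m diag_mx sp *m P.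
  by move/orthomx_spectralP: (An); rewrite -/P -/sp invmx_unitary.
have sp0 i : 0 <= sp 0 i.
  have := pA (row i P).
  have -> : row i P *m A *m (row i P)^t* = row i (P *m A *m P^t*) *m delta_mx i 0.
    by rewrite !row_mul -!mulmxA; congr (_ *m (_ *m _));
      rewrite -colE; apply/matrixP => a b; rewrite !mxE.
  rewrite EA !mulmxA PP mul1mx -mulmxA PP mulmx1 -colE !mxE eqxx.
  by rewrite mulr1n.
exists (fun a => rc (Num.sqrt (complex.Re (sp 0 a))) *: col a (P^t*)).
rewrite {1}EA -mulmxA; apply/matrixP => x y; rewrite summxE mxE.
apply: eq_bigr => a _; rewrite mul_diag_mx !mxE big_ord1 !mxE.
rewrite rmorphM /= conj_rc conjCK mulrACA -rmorphM /= -expr2 sqr_sqrtr; last exact: Re_ge0.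
by rewrite RRe_real ?ger0_real //; ring.
Qed.

(* Choi's theorem: the vectors of a decomposition of the Choi matrix of [K],
   reshaped into matrices, are Kraus operators. *)
Lemma channel_kraus d (K : 'M[C]_d -> 'M[C]_d) : quantum_channel K ->
  exists W : 'I_(d * d) -> 'M[C]_d,
    K =1 (fun X => \sum_a W a *m X *m (W a)^t*) /\
    forall u, \sum_a nrm2 (W a *m u) = nrm2 u.
Proof.
move=> [lK cpK tpK].
(* The unnormalised maximally entangled vector: the blocks of z z^* are the matrix units, so the
   image of z z^* records [K] on a basis. *)
pose z : 'cV[C]_(d * d) :=
  \col_x ((mxtens_unindex x).1 == (mxtens_unindex x).2)%:R.
have pz : psdmx (z *m z^t*).
  move=> v; rewrite mulmxA -mulmxA -adjM mxE big_ord1 !mxE.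
  exact: mul_conjC_ge0.
have [w Ew] := psdmx_decomp (cpK d _ pz).
have zb i j : tens_block (z *m z^t*) i j = delta_mx i j.
  apply/matrixP => a b; rewrite !mxE big_ord1 !mxE !mxtens_indexK /= conjC_nat.
  by rewrite -natrM mulnb [i == a]eq_sym [j == b]eq_sym.
pose W a : 'M[C]_d := \matrix_(p, i) w a (mxtens_index (i, p)) 0.
have KW : K =1 (fun X => \sum_a W a *m X *m (W a)^t*).
  move=> X.
  pose f : {linear 'M[C]_d -> 'M[C]_d} :=
    HB.pack K (GRing.isLinear.Build _ _ _ _ K lK).
  pose g : {linear 'M[C]_d -> 'M[C]_d} :=
    HB.pack (fun X => \sum_a W a *m X *m (W a)^t*)
      (GRing.isLinear.Build _ _ _ _ _ (kraus_linear W)).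
  rewrite -[K]/(f : _ -> _) -[RHS]/(g X) [X]matrix_sum_delta !linear_sum.
  apply: eq_bigr => i _; rewrite !linear_sum; apply: eq_bigr => j _.
  rewrite !linearZ; congr (_ *: _); rewrite /f /g /= -zb -tens_block_tens_id Ew zb.
  apply/matrixP => p q; rewrite mxE !summxE; apply: eq_bigr => a _.
  rewrite -(mul_delta_mx (0 : 'I_1)) mulmxA -colE -mulmxA -rowE.
  by rewrite !mxE !big_ord1 !mxE.
(* The length identity is trace preservation at the operator u u^*. *)
exists W; split=> // u; rewrite /nrm2 [RHS]ripE /rtr -tpK KW -/(rtr _) rtr_sum.
by apply: eq_bigr => a _; rewrite ripE adjM !mulmxA.
Qed.

Lemma channel_dbound d (K : 'M[C]_d -> 'M[C]_d) :
  quantum_channel K -> dbound K 1.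
Proof.
move=> /channel_kraus[W [KW hW]]; apply: eq_dbound KW _.
by apply: dbound_kraus => // u; rewrite hW mul1r.
Qed.

(** Writing S = sum_a w_a w_a^*, the operators w_a e_j^* form a Kraus family, because the sum over j
    of e_j^* X e_j is tr X. Their total weight is sum_a |w_a|^2 = tr S = 1. *)
Lemma prepare_dbound d (S : 'M[C]_d) : density S ->
  dbound (fun X => \tr X *: S) 1.
Proof.
move=> [/psdmx_decomp[w Ew] trS].
pose W (aj : 'I_d * 'I_d) : 'M[C]_d := w aj.1 *m delta_mx 0 aj.2.
apply: (@eq_dbound _ _ _ (fun X => \sum_a W a *m X *m (W a)^t*)).
  move=> X; rewrite -(pair_bigA _ (fun a j => W (a, j) *m X *m (W (a, j))^t*)) /=.
  rewrite Ew scaler_sumr; apply: eq_bigr => a _.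
  rewrite /mxtrace scaler_suml; apply: eq_bigr => j _.
  rewrite /W /= adjM adj_delta !mulmxA -(mulmxA (w a)) -rowE -(mulmxA (w a)) -colE.
  have -> : col j (row j X) = (X j j)%:M.
    by apply/matrixP => p q; rewrite !ord1 !mxE eqxx mulr1n.
  by rewrite mul_mx_scalar -scalemxAl.
apply: dbound_kraus => // u; rewrite mul1r.
rewrite -(pair_bigA _ (fun a j => nrm2 (W (a, j) *m u))) /=.
under eq_bigr => a _.
  under eq_bigr => j _.
    rewrite /W /= -mulmxA -rowE.
    have -> : row j u = (u j 0)%:M.
      by apply/matrixP => p q; rewrite !ord1 !mxE eqxx mulr1n.
    rewrite mul_mx_scalar nrm2Z; over.
  rewrite -mulr_suml -nrm2E; over.
rewrite -mulr_sumr; have -> : \sum_a nrm2 (w a) = 1.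
  have /(congr1 (@complex.Re R)) := trS; rewrite -/(rtr _) Ew rtr_sum /= => <-.
  by apply: eq_bigr => a _; rewrite -ripE.
by rewrite mulr1.
Qed.

Lemma oracle_dbound d (S : stoch_sim R d) i : dbound (oracle (S := S) i) 1.
Proof.
case: i => [j|] /=; last exact/prepare_dbound/ss_state_density.
by apply: dbound_contr2; apply/unitary_contr/ss_U_unitary.
Qed.

Lemma oracle_prob_ge0 d (S : stoch_sim R d) i : 0 <= oracle_prob (S := S) i.
Proof.
have /andP[q0 q1] := ss_q_itv S; case: i => [j|] /=; last by rewrite subr_ge0.
by rewrite mulr_ge0 //; have /andP[] := ss_lambda_itv j.
Qed.

Lemma big_option (V : nmodType) (I : finType) (F : option I -> V) :
  \sum_a F a = F None + \sum_i F (Some i).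
Proof.
rewrite -big_enum (_ : enum _ = None :: map some (enum I)).
  by rewrite big_cons big_map big_enum.
by rewrite !enumT [in LHS]unlock.
Qed.

Lemma oracle_prob_sum d (S : stoch_sim R d) : \sum_i oracle_prob (S := S) i = 1.
Proof.
by rewrite big_option /= -mulr_sumr ss_lambda_sum mulr1 subrK.
Qed.

Lemma oracle_linear d (S : stoch_sim R d) i : linear (oracle (S := S) i).
Proof.
move=> z X Y; case: i => [j|] /=.
  by rewrite mulmxDr mulmxDl -scalemxAr -scalemxAl.
by rewrite mxtraceD mxtraceZ scalerDl scalerA.
Qed.

Lemma ss_channel_linear d (S : stoch_sim R d) : linear (ss_channel S).
Proof.
move=> z X Y; rewrite /ss_channel scaler_sumr -big_split /=.
apply: eq_bigr => i _; rewrite oracle_linear scalerDr !scalerA.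
by rewrite [z * _]mulrC.
Qed.

Lemma ss_channel_dbound d (S : stoch_sim R d) : dbound (ss_channel S) 1.
Proof.
have -> : 1 = \sum_(i : ss_index S) oracle_prob i * 1 :> R.
  by under eq_bigr do rewrite mulr1; rewrite oracle_prob_sum.
apply: dbound_sum => i _; apply: dboundZr; first exact: oracle_prob_ge0.
exact: oracle_dbound.
Qed.

End Channels.

(** * Convergence of the exponential series of a linear map *)

Section Exponential.
Variable R : realType.
Local Notation C := R[i].
Local Notation rc := (real_complex R).
Local Open Scope classical_set_scope.

Lemma cabs_le_ReIm (z : C) : cabs z <= `|complex.Re z| + `|complex.Im z|.
Proof.
rewrite /cabs normc_def /= -[leRHS]ger0_norm ?addr_ge0 // -sqrtr_sqr.
apply: ler_wsqrtr; rewrite sqrrD !real_normK ?num_real // lerD2r lerDl.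
by rewrite mulrn_wge0 // mulr_ge0.
Qed.

Lemma normRe_le_cabs (z : C) : `|complex.Re z| <= cabs z.
Proof. by have := normc_ge_Re z; rewrite cabsE lecR. Qed.

Lemma normIm_le_cabs (z : C) : `|complex.Im z| <= cabs z.
Proof.
rewrite /cabs normc_def /= -sqrtr_sqr; apply: ler_wsqrtr.
by rewrite lerDr sqr_ge0.
Qed.

(** [exp_super] is a limit for the entrywise topology, whereas all estimates are in trace norm;
    [mx_cvg_tn] passes from the former to the latter. *)
Definition tn_cvg d (u : nat -> 'M[C]_d) (l : 'M[C]_d) :=
  forall e, 0 < e -> \forall j \near \oo, trace_norm (u j - l) <= e.

Lemma mx_cvg_tn d (u : nat -> 'MC[R]_d) (l : 'MC[R]_d) :
  (u j @[j --> \oo] --> l) -> tn_cvg u l.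
Proof.
(* Each of the d^2 entries is allowed e / c; the added 1 keeps [c] positive when d = 0. *)
move=> ul e e0; pose c : R := d%:R * d%:R + 1.
have c0 : 0 < c by rewrite ltr_wpDl // mulr_ge0.
have e'0 : 0 < rc (e / c) by rewrite ltcR divr_gt0.
have [N _ hN] := cvg_ball ul e'0.
exists N => // j Nj; have [_ h] := hN j Nj; rewrite /=.
apply: le_trans (tn_le_entries _) _.
apply: (@le_trans _ _ (\sum_(i < d) \sum_(k < d) e / c)).
  apply: ler_sum => i _; apply: ler_sum => k _.
  have := h i k; rewrite -ball_normE /= distrC => /ltW.
  by rewrite !mxE cabsE lecR.
rewrite !sumr_const !card_ord -mulrnA -mulr_natr natrM mulrAC.
by rewrite ler_pdivrMr // ler_wpM2l ?ltW // ltrDl.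
Qed.

(** Splitting entries into real and imaginary parts brings the exponential under the comparison test
    for real series. *)
Lemma entries_mx_cvg d (u : nat -> 'MC[R]_d) (a b : 'I_d -> 'I_d -> R) :
  (forall p q, complex.Re (u j p q) @[j --> \oo] --> a p q) ->
  (forall p q, complex.Im (u j p q) @[j --> \oo] --> b p q) ->
  u j @[j --> \oo] --> (\matrix_(p, q) (a p q +i* b p q)%C : 'MC[R]_d).
Proof.
move=> ha hb; apply/cvg_ballP => eps eps0.
have e2 : 0 < complex.Re eps / 2.
  by move: eps0; rewrite ltcE /= => /andP[_ ?]; rewrite divr_gt0.
have epsE : eps = rc (complex.Re eps).
  by move: eps0; rewrite ltcE => /andP[/eqP h _]; case: (eps) h => x y /= ->.
suff : \forall j \near \oo, forall p q,
    `|complex.Re (u j p q) - a p q| + `|complex.Im (u j p q) - b p q|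
      < complex.Re eps.
  apply: filterS => j h; split=> // p q; rewrite -ball_normE /= mxE.
  rewrite cabsE epsE ltcR; apply: le_lt_trans (cabs_le_ReIm _) _.
  move: (h p q); case: (u j p q) => x y /=.
  by rewrite ![`|_ - a p q|]distrC ![`|_ - b p q|]distrC.
apply: filter_forall => p; apply: filter_forall => q.
have /cvgrPdist_lt/(_ _ e2) := ha p q; have /cvgrPdist_lt/(_ _ e2) := hb p q.
apply: filterS2 => j; rewrite ![`|a p q - _|]distrC ![`|b p q - _|]distrC.
lra.
Qed.

Definition exp_psum d (t : R) (M : 'M[C]_d -> 'M[C]_d) (j : nat)
    (X : 'M[C]_d) : 'M[C]_d :=
  \sum_(k < j) rc (t ^+ k / k`!%:R) *: iter k M X.

Lemma exp_series_bounded (t c x : R) (a : nat -> R) : 0 <= c -> 0 <= x ->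
  (forall k, `|a k| <= c ^+ k * x) ->
  cvgn (fun j => \sum_(k < j) t ^+ k / k`!%:R * a k).
Proof.
move=> c0 x0 h.
have -> : (fun j => \sum_(k < j) t ^+ k / k`!%:R * a k) =
    series (fun k => t ^+ k / k`!%:R * a k).
  by apply/funext => j; rewrite /series /= big_mkord.
apply: normed_cvg; rewrite /=.
apply: (@series_le_cvg _ _ (fun k => exp_coeff (`|t| * c) k * x)).
- by move=> n /=.
- move=> n /=; rewrite mulr_ge0 // /exp_coeff /= divr_ge0 //.
  by rewrite exprn_ge0 // mulr_ge0.
- move=> n /=; rewrite !normrM normrX normfV normr_nat /exp_coeff /= exprMn.
  rewrite -!mulrA ler_wpM2l ?exprn_ge0 // mulrCA ler_wpM2l ?invr_ge0 //.
rewrite (_ : series _ = (fun n => series (exp_coeff (`|t| * c)) n * x)).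
  by apply: is_cvgM; [exact: is_cvg_series_exp_coeff | exact: is_cvg_cst].
by apply/funext => n; rewrite /series /= mulr_suml.
Qed.

Lemma tn_iter d (M : 'M[C]_d -> 'M[C]_d) c : 0 <= c ->
  (forall X, trace_norm (M X) <= c * trace_norm X) ->
  forall k X, trace_norm (iter k M X) <= c ^+ k * trace_norm X.
Proof.
move=> c0 h; elim=> [|k IH] X; first by rewrite mul1r.
rewrite iterS exprS -mulrA; apply: le_trans (h _) _.
by rewrite ler_wpM2l.
Qed.

Lemma exp_super_cvg d (M : 'M[C]_d -> 'M[C]_d) t (X : 'M[C]_d) : linear M ->
  tn_cvg (fun j => exp_psum t M j X) (exp_super t M X).
Proof.
move=> /linear_tn_bounded[c c0 hc]; apply: mx_cvg_tn.
have hk k p q : cabs (iter k M X p q) <= c ^+ k * trace_norm X.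
  by apply: le_trans (entry_le_tn _ _ _) (tn_iter c0 hc _ _).
have hre p q : cvgn (fun j => complex.Re (exp_psum t M j X p q)).
  rewrite (_ : (fun j => _) =
    (fun j => \sum_(k < j) t ^+ k / k`!%:R * complex.Re (iter k M X p q))).
    refine (@exp_series_bounded t c (trace_norm X)
      (fun k => complex.Re (iter k M X p q)) c0 (tn_ge0 X) _) => k.
    exact: le_trans (normRe_le_cabs _) (hk _ _ _).
  apply/funext => j; rewrite /exp_psum summxE Re_sum; apply: eq_bigr => k _.
  by rewrite mxE Re_rcM.
have him p q : cvgn (fun j => complex.Im (exp_psum t M j X p q)).
  rewrite (_ : (fun j => _) =
    (fun j => \sum_(k < j) t ^+ k / k`!%:R * complex.Im (iter k M X p q))).
    refine (@exp_series_bounded t c (trace_norm X)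
      (fun k => complex.Im (iter k M X p q)) c0 (tn_ge0 X) _) => k.
    exact: le_trans (normIm_le_cabs _) (hk _ _ _).
  apply/funext => j; rewrite /exp_psum summxE.
  rewrite (big_morph (@complex.Im R) (id1 := 0) (op1 := +%R)) //; last first.
    by move=> [? ?] [? ?].
  apply: eq_bigr => k _; rewrite mxE; case: (iter k M X p q) => x y /=.
  by rewrite mul0r addr0.
(* [limn] is meaningful only on convergent sequences: exhibiting some limit is what makes
   [exp_super] the sum of its series. *)
have := @entries_mx_cvg d (fun j => exp_psum t M j X) _ _ hre him.
by move=> /cvgP.
Qed.

End Exponential.

Local Opaque exp_super.

(** * Semigroup law, Taylor remainder and contractivity criterion for exponentials *)

Section ExponentialTheory.
Variable R : realType.
Local Notation C := R[i].
Local Notation rc := (real_complex R).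
Local Open Scope classical_set_scope.

Lemma le_add_eps (a b : R) : (forall e, 0 < e -> a <= b + e) -> a <= b.
Proof. by move=> h; apply/ler_addgt0Pr. Qed.

Lemma tn_cvg_le d (u : nat -> 'M[C]_d) l c : tn_cvg u l ->
  (\forall j \near \oo, trace_norm (u j) <= c) -> trace_norm l <= c.
Proof.
move=> ul uc; apply: le_add_eps => e e0.
have [j [h1 h2]] := filter_ex (filterI (ul e e0) uc).
have -> : l = u j - (u j - l) by rewrite opprB addrC subrK.
by apply: le_trans (tnB _ _) (lerD _ _).
Qed.

Lemma tn_cvg_uniq d (u : nat -> 'M[C]_d) l l' :
  tn_cvg u l -> tn_cvg u l' -> l = l'.
Proof.
move=> ul ul'; apply/eqP; rewrite -subr_eq0; apply/eqP/tn_eq0/eqP.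
rewrite eq_le tn_ge0 andbT; apply: le_add_eps => e e0; rewrite add0r.
have e2 : 0 < e / 2 by rewrite divr_gt0.
have [j [h1 h2]] := filter_ex (filterI (ul _ e2) (ul' _ e2)).
have -> : l - l' = (u j - l') - (u j - l) by rewrite opprB [RHS]addrC addrA subrK.
by rewrite (splitr e); apply: le_trans (tnB _ _) (lerD h2 h1).
Qed.

Lemma tn_cvg_eq d (u v : nat -> 'M[C]_d) l :
  (\forall j \near \oo, u j = v j) -> tn_cvg v l -> tn_cvg u l.
Proof.
by move=> uv vl e e0; move: (vl e e0); apply: filterS2 uv => j ->.
Qed.

Lemma tn_cvgD d (u v : nat -> 'M[C]_d) l l' :
  tn_cvg u l -> tn_cvg v l' -> tn_cvg (fun j => u j + v j) (l + l').
Proof.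
move=> ul vl e e0; have e2 : 0 < e / 2 by rewrite divr_gt0.
move: (ul _ e2) (vl _ e2); apply: filterS2 => j h1 h2.
rewrite opprD addrACA; by rewrite (splitr e); apply: le_trans (tnD _ _) (lerD h1 h2).
Qed.

Lemma tn_cvg_cst d (l : 'M[C]_d) : tn_cvg (fun=> l) l.
Proof. by move=> e e0; apply: nearW => j; rewrite subrr tn0 ltW. Qed.

Lemma tn_cvg_shift d k (u : nat -> 'M[C]_d) l :
  tn_cvg u l -> tn_cvg (fun j => u (k + j)%N) l.
Proof.
move=> ul e e0; have [N _ hN] := ul e e0; exists N; first by [].
move=> j /= Nj; apply: (hN (k + j)%N).
exact: leq_trans Nj (leq_addl k j).
Qed.

Lemma tn_cvg_map d d' (F : 'M[C]_d -> 'M[C]_d') c (u : nat -> 'M[C]_d) l :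
  0 <= c -> (forall X Y, trace_norm (F X - F Y) <= c * trace_norm (X - Y)) ->
  tn_cvg u l -> tn_cvg (F \o u) (F l).
Proof.
move=> c0 hF ul e e0; have e' : 0 < e / (c + 1) by rewrite divr_gt0 // ltr_wpDl.
move: (ul _ e'); apply: filterS => j h /=; apply: le_trans (hF _ _) _.
apply: le_trans (ler_wpM2l c0 h) _.
by rewrite mulrCA ler_piMr ?(ltW e0) // ler_pdivrMr ?ltr_wpDl // mul1r lerDl.
Qed.

Lemma linear_lipschitz d d' (F : 'M[C]_d -> 'M[C]_d') : linear F ->
  exists2 c, 0 <= c &
  forall X Y, trace_norm (F X - F Y) <= c * trace_norm (X - Y).
Proof.
move=> lF; have [c c0 hc] := linear_tn_bounded lF; exists c => // X Y.
have -> : F X - F Y = F (X - Y) by rewrite addrC -scaleN1r -lF scaleN1r addrC.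
exact: hc.
Qed.

Lemma tn_cvg_linear d d' (F : 'M[C]_d -> 'M[C]_d') (u : nat -> 'M[C]_d) l :
  linear F -> tn_cvg u l -> tn_cvg (F \o u) (F l).
Proof. by move=> /linear_lipschitz[c c0 hc] ul; apply: tn_cvg_map c0 hc ul. Qed.

Lemma tn_cvg_tens_id d (E : nat -> 'M[C]_d -> 'M[C]_d) (F : 'M[C]_d -> 'M[C]_d)
    (X : 'M[C]_(d * d)) :
  (forall Y, tn_cvg (E^~ Y) (F Y)) ->
  tn_cvg (fun j => tens_id (E j) X) (tens_id F X).
Proof.
move=> EF e e0; pose c : R := (d * d)%:R * (d * d)%:R + 1.
have c0 : 0 < c by rewrite ltr_wpDl // mulr_ge0.
have e' : 0 < e / c by rewrite divr_gt0.
have : \forall j \near \oo, forall i k,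
    trace_norm (E j (tens_block X i k) - F (tens_block X i k)) <= e / c.
  by apply: filter_forall => i; apply: filter_forall => k; exact: EF.
apply: filterS => j h; apply: le_trans (tn_le_entries _) _.
apply: (@le_trans _ _ (\sum_(i < d * d) \sum_(k < d * d) e / c)).
  apply: ler_sum => x _; apply: ler_sum => y _.
  case: (mxtens_indexP x) => i a; case: (mxtens_indexP y) => k b.
  apply: le_trans (h i k); apply: le_trans (entry_le_tn _ a b).
  by rewrite -(tens_block_tens_id (E j)) -(tens_block_tens_id F) !mxE.
rewrite !sumr_const !card_ord -mulrnA -mulr_natr natrM mulrAC.
by rewrite ler_pdivrMr // ler_wpM2l ?ltW // ltrDl.
Qed.

Lemma dbound_lim d (E : nat -> 'M[C]_d -> 'M[C]_d) (F : 'M[C]_d -> 'M[C]_d) c :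
  (forall Y, tn_cvg (E^~ Y) (F Y)) ->
  (\forall j \near \oo, dbound (E j) c) -> dbound F c.
Proof.
move=> EF Ec X; apply: tn_cvg_le (tn_cvg_tens_id X EF) _.
by move: Ec; apply: filterS => j; apply.
Qed.

Lemma linear_iter d (M : 'M[C]_d -> 'M[C]_d) k : linear M -> linear (iter k M).
Proof. by move=> lM; elim: k => [|k IH] z X Y //=; rewrite IH lM. Qed.

Lemma exp_psum_linear d t (M : 'M[C]_d -> 'M[C]_d) j :
  linear M -> linear (exp_psum t M j).
Proof.
move=> lM z X Y; rewrite /exp_psum scaler_sumr -big_split /=.
apply: eq_bigr => k _; rewrite (linear_iter _ lM) scalerDr !scalerA.
by rewrite [z * _]mulrC.
Qed.

Lemma scale_linear d z : linear (fun X : 'M[C]_d => z *: X).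
Proof. by move=> a X Y; rewrite scalerDr !scalerA mulrC. Qed.

Lemma exp_super_linear d t (M : 'M[C]_d -> 'M[C]_d) :
  linear M -> linear (exp_super t M).
Proof.
move=> lM z X Y; apply: (tn_cvg_uniq (exp_super_cvg t _ lM)).
apply: (@tn_cvg_eq _ _ (fun j => z *: exp_psum t M j X + exp_psum t M j Y)).
  by apply: nearW => j; rewrite exp_psum_linear.
apply: tn_cvgD (exp_super_cvg t _ lM).
exact: (tn_cvg_linear (scale_linear z) (exp_super_cvg t X lM)).
Qed.

Lemma exp_super0 d (M : 'M[C]_d -> 'M[C]_d) X : linear M -> exp_super 0 M X = X.
Proof.
move=> lM; apply: (tn_cvg_uniq (exp_super_cvg 0 X lM)).
(* The partial sum of index 0 is empty; from index 1 on they all equal [X]. *)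
apply: tn_cvg_eq (tn_cvg_cst X); exists 1%N => // -[//|j] _ /=.
rewrite /exp_psum big_ord_recl /= big1 ?addr0 => [|i _].
  by rewrite expr0 divr1 scale1r.
by rewrite exprS !mul0r scale0r.
Qed.

(** Truncation of e^N, with the time absorbed into [N] so that half steps and full steps are treated
    alike. *)
Definition taylor2 d (N : 'M[C]_d -> 'M[C]_d) (X : 'M[C]_d) : 'M[C]_d :=
  X + (N X + rc 2^-1 *: N (N X)).

(** The ratio of consecutive terms is at most y / 4 <= 1/2, so the tail is at most twice its first
    term y^3/6. The range extends to 2 because the full generator of a step has norm up to 2. *)
Lemma exp_tail_le (y : R) n : 0 <= y <= 2 ->
  \sum_(i < n) y ^+ (3 + i) / (3 + i)`!%:R <= y ^+ 3 / 3.
Proof.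
move=> /andP[y0 y2].
have h i : y ^+ (3 + i) / (3 + i)`!%:R <= y ^+ 3 / 6 * 2^-1 ^+ i.
  elim: i => [|i IH]; first by rewrite addn0 expr0 mulr1.
  rewrite addnS (exprS y (3 + i)) factS natrM invfM (exprS 2^-1 i).
  have -> : y * y ^+ (3 + i) * ((3 + i).+1%:R^-1 * (3 + i)`!%:R^-1) =
    y / (3 + i).+1%:R * (y ^+ (3 + i) / (3 + i)`!%:R) :> R by ring.
  rewrite [leRHS]mulrCA; apply: ler_pM => //.
  - by rewrite divr_ge0.
  - by rewrite divr_ge0 // exprn_ge0.
  rewrite ler_pdivrMr // mulrC ler_pdivlMr //.
  have : (4%:R : R) <= (3 + i).+1%:R by rewrite ler_nat.
  lra.
apply: (@le_trans _ _ (y ^+ 3 / 6 * (2 - 2 * 2^-1 ^+ n))).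
  elim: n => [|n IH]; first by rewrite big_ord0 expr0 mulr1 subrr mulr0.
  rewrite big_ord_recr /=; apply: le_trans (lerD IH (h n)) _.
  rewrite (exprS 2^-1 n); lra.
have y3 : 0 <= y ^+ 3 / 6 by rewrite divr_ge0 // exprn_ge0.
have h2 : 0 <= 2^-1 ^+ n :> R by rewrite exprn_ge0.
have := mulr_ge0 y3 h2; lra.
Qed.

Lemma dbound_iter d (M : 'M[C]_d -> 'M[C]_d) x k : 0 <= x ->
  dbound M x -> dbound (iter k M) (x ^+ k).
Proof.
move=> x0 hM; elim: k => [|k IH]; first exact: dbound_id.
by rewrite exprS; exact: dbound_comp.
Qed.

Lemma sum_ord3 (V : nmodType) (F : nat -> V) :
  \sum_(i < 3) F i = F 0%N + (F 1%N + F 2%N).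
Proof. by rewrite !big_ord_recr big_ord0 /= add0r addrA. Qed.

Lemma exp_taylor2 d (M : 'M[C]_d -> 'M[C]_d) t x : linear M ->
  0 <= t -> 0 <= x -> dbound M x -> t * x <= 2 ->
  dbound (exp_super t M \- taylor2 (fun X => rc t *: M X)) ((t * x) ^+ 3 / 3).
Proof.
move=> lM t0 x0 hM y2.
pose T j X := \sum_(k < j) rc (t ^+ (3 + k) / (3 + k)`!%:R) *: iter (3 + k) M X.
have MZ (z : C) X : M (z *: X) = z *: M X.
  have M0 : M 0 = 0 by have := lM (-1) 0 0; rewrite scaler0 addr0 scaleN1r addNr.
  by have := lM z X 0; rewrite M0 !addr0.
apply: (@dbound_lim _ T) => [X|]; last first.
  apply: nearW => j; apply: (dbound_le (exp_tail_le j _)).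
    by rewrite mulr_ge0.
  rewrite /T; apply: eq_dbound (fun _ => erefl) _.
  apply: dbound_sum => k _.
  have -> : (t * x) ^+ (3 + k) / (3 + k)`!%:R =
    t ^+ (3 + k) / (3 + k)`!%:R * x ^+ (3 + k) by rewrite exprMn mulrAC.
  refine (@dboundZr _ _ (iter (3 + k) M) _ _ _ _).
    by rewrite divr_ge0 // exprn_ge0.
  exact: dbound_iter.
have E j : exp_psum t M (3 + j) X = taylor2 (fun X => rc t *: M X) X + T j X.
  rewrite /exp_psum big_split_ord; congr (_ + _).
  rewrite (sum_ord3 (fun k => rc (t ^+ k / k`!%:R) *: iter k M X)) /taylor2 MZ.
  have e0 : rc (t ^+ 0 / 0`!%:R) = 1 by rewrite expr0 divr1.
  have e1 : rc (t ^+ 1 / 1`!%:R) = rc t by rewrite expr1 divr1.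
  have e2 : rc (t ^+ 2 / 2`!%:R) = rc 2^-1 * (rc t * rc t).
    by rewrite -!rmorphM expr2 mulrC.
  by rewrite e0 e1 e2 scale1r -!scalerA.
have h := tn_cvgD (tn_cvg_shift 3 (exp_super_cvg t X lM))
  (tn_cvg_cst (- taylor2 (fun X => rc t *: M X) X)).
by apply: tn_cvg_eq h; apply: nearW => j; rewrite E [RHS]addrC addKr.
Qed.

(** The square of indices is the triangle a + b < j, summed along antidiagonals, plus the
    complementary triangle: a Cauchy product before the passage to the limit. *)
Lemma cauchy_split (V : nmodType) (G : nat -> nat -> V) j :
  \sum_(0 <= a < j) \sum_(0 <= b < j) G a b =
  \sum_(0 <= k < j) \sum_(0 <= a < k.+1) G a (k - a)%N +
  \sum_(0 <= a < j) \sum_(j - a <= b < j) G a b.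
Proof.
have -> : \sum_(0 <= k < j) \sum_(0 <= a < k.+1) G a (k - a)%N =
    \sum_(0 <= a < j) \sum_(0 <= b < j - a) G a b.
  elim: j => [|j IH]; first by rewrite !big_nil.
  rewrite big_nat_recr //= IH [in LHS]big_nat_recr //= [RHS]big_nat_recr //=.
  rewrite subnn subSnn big_nat1 addrA; congr (_ + _).
  rewrite -big_split !big_nat; apply: eq_bigr => a /andP[_ aj].
  by rewrite subSn ?(ltnW aj) // big_nat_recr.
rewrite -big_split; apply: eq_bigr => a _.
by rewrite -big_cat_nat // leq_subr.
Qed.

Lemma exp_coefD (s t : R) k :
  \sum_(0 <= a < k.+1) s ^+ a / a`!%:R * (t ^+ (k - a) / (k - a)`!%:R) =
  (s + t) ^+ k / k`!%:R.
Proof.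
rewrite addrC exprDn mulr_suml big_mkord; apply: eq_bigr => a _.
have ak : (a <= k)%N by rewrite -ltnS.
have f0 m : m`!%:R != 0 :> R by rewrite pnatr_eq0 -lt0n fact_gt0.
rewrite -(bin_fact ak) !natrM -mulr_natr.
have b0 : 'C(k, a)%:R != 0 :> R by rewrite pnatr_eq0 -lt0n bin_gt0.
by field; rewrite !f0 b0.
Qed.

Definition exp_poly (y : R) (j : nat) : R := \sum_(0 <= k < j) y ^+ k / k`!%:R.

Lemma exp_poly_cvg y : exp_poly y j @[j --> \oo] --> expR y.
Proof. exact: is_cvg_series_exp_coeff. Qed.

Lemma exp_poly_le y j : 0 <= y -> exp_poly y j <= expR y.
Proof.
move=> y0; apply: (nondecreasing_cvgn_le _ (is_cvg_series_exp_coeff y)).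
apply/nondecreasing_seqP => n; rewrite /series /= big_nat_recr //= lerDl.
by rewrite /exp_coeff /= divr_ge0 // exprn_ge0.
Qed.

Lemma exp_psumE d t (M : 'M[C]_d -> 'M[C]_d) j X :
  exp_psum t M j X = \sum_(0 <= k < j) rc (t ^+ k / k`!%:R) *: iter k M X.
Proof. by rewrite big_mkord. Qed.

(* The difference is a polynomial in [M] with nonnegative coefficients, so that
   its norm is at most its value at the norm [c] of [M]. *)
Lemma exp_psum_mul d s t (M : 'M[C]_d -> 'M[C]_d) c j X : linear M ->
  0 <= s -> 0 <= t -> 0 <= c ->
  (forall X, trace_norm (M X) <= c * trace_norm X) ->
  trace_norm (exp_psum s M j (exp_psum t M j X) - exp_psum (s + t) M j X) <=
  (exp_poly (s * c) j * exp_poly (t * c) j - exp_poly ((s + t) * c) j)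
    * trace_norm X.
Proof.
move=> lM s0 t0 c0 hc.
pose g a b := s ^+ a / a`!%:R * (t ^+ b / b`!%:R).
have g0 a b : 0 <= g a b by rewrite mulr_ge0 // divr_ge0 // exprn_ge0.
pose f k : {linear 'M[C]_d -> 'M[C]_d} :=
  HB.pack (iter k M) (GRing.isLinear.Build _ _ _ _ _ (linear_iter k lM)).
have -> : exp_psum s M j (exp_psum t M j X) - exp_psum (s + t) M j X =
    \sum_(0 <= a < j) \sum_(j - a <= b < j) rc (g a b) *: iter (a + b) M X.
  apply/eqP; rewrite subr_eq addrC; apply/eqP.
  have -> : exp_psum (s + t) M j X = \sum_(0 <= k < j)
      \sum_(0 <= a < k.+1) rc (g a (k - a)%N) *: iter (a + (k - a)) M X.
    rewrite exp_psumE; apply: eq_bigr => k _.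
    rewrite -exp_coefD rmorph_sum scaler_suml !big_nat; apply: eq_bigr => a.
    by rewrite ltnS => /subnKC ->.
  rewrite -(cauchy_split (fun a b => rc (g a b) *: iter (a + b) M X)).
  rewrite !exp_psumE; apply: eq_bigr => a _.
  rewrite -[iter a M _]/(f a _) linear_sum scaler_sumr; apply: eq_bigr => b _.
  by rewrite linearZ scalerA -rmorphM /= iterD.
have -> : exp_poly (s * c) j * exp_poly (t * c) j - exp_poly ((s + t) * c) j =
    \sum_(0 <= a < j) \sum_(j - a <= b < j) g a b * c ^+ (a + b).
  apply/eqP; rewrite subr_eq addrC; apply/eqP.
  have -> : exp_poly ((s + t) * c) j = \sum_(0 <= k < j)
      \sum_(0 <= a < k.+1) g a (k - a)%N * c ^+ (a + (k - a)).
    apply: eq_bigr => k _.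
    rewrite exprMn mulrAC -exp_coefD mulr_suml !big_nat; apply: eq_bigr => a.
    by rewrite ltnS => /subnKC ->.
  rewrite -(cauchy_split (fun a b => g a b * c ^+ (a + b))).
  rewrite /exp_poly mulr_suml; apply: eq_bigr => a _.
  rewrite mulr_sumr; apply: eq_bigr => b _.
  rewrite /g !exprMn exprD; ring.
rewrite mulr_suml; apply: le_trans (tn_sum _ _ _) _; apply: ler_sum => a _.
rewrite mulr_suml; apply: le_trans (tn_sum _ _ _) _; apply: ler_sum => b _.
apply: le_trans (tnZr _ _) _; rewrite ger0_norm // -(mulrA (g a b)) ler_wpM2l //.
exact: tn_iter.
Qed.

Lemma exp_psum_lipschitz d t (M : 'M[C]_d -> 'M[C]_d) c j : linear M ->
  0 <= t -> 0 <= c -> (forall X, trace_norm (M X) <= c * trace_norm X) ->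
  forall X, trace_norm (exp_psum t M j X) <= expR (t * c) * trace_norm X.
Proof.
move=> lM t0 c0 hc X; apply: (@le_trans _ _ (exp_poly (t * c) j * trace_norm X)).
  rewrite exp_psumE /exp_poly mulr_suml.
  apply: le_trans (tn_sum _ _ _) _; apply: ler_sum => k _.
  apply: le_trans (tnZr _ _) _.
  have -> : (t * c) ^+ k / k`!%:R = t ^+ k / k`!%:R * c ^+ k.
    by rewrite exprMn mulrAC.
  rewrite ger0_norm ?divr_ge0 ?exprn_ge0 // -(mulrA (t ^+ k / k`!%:R)).
  by rewrite ler_wpM2l ?divr_ge0 ?exprn_ge0 // tn_iter.
by rewrite ler_wpM2r ?tn_ge0 // exp_poly_le // mulr_ge0.
Qed.

Lemma exp_superD d s t (M : 'M[C]_d -> 'M[C]_d) X : linear M ->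
  0 <= s -> 0 <= t -> exp_super (s + t) M X = exp_super s M (exp_super t M X).
Proof.
move=> lM s0 t0; have [c c0 hc] := linear_tn_bounded lM.
apply: (tn_cvg_uniq (exp_super_cvg (s + t) X lM)) => e e0.
have e3 : 0 < e / 3 by rewrite divr_gt0.
pose x := trace_norm X; have x0 : 0 <= x := tn_ge0 X.
pose K := expR (s * c); have K0 : 0 < K := expR_gt0 _.
have e3K : 0 < e / 3 / K by rewrite divr_gt0.
have e3x : 0 < e / 3 / (x + 1) by rewrite divr_gt0 // ltr_wpDl.
have h1 := exp_super_cvg s (exp_super t M X) lM e3.
have h2 := exp_super_cvg t X lM e3K.
(* The defect of the Cauchy product is dominated by that of real exponentials, for which the
   addition formula is known. *)
have h3 : exp_poly (s * c) j * exp_poly (t * c) j - exp_poly ((s + t) * c) j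
    @[j --> \oo] --> (0 : R).
  rewrite (_ : 0 = expR (s * c) * expR (t * c) - expR ((s + t) * c)).
    by apply: cvgB; [apply: cvgM|]; exact: exp_poly_cvg.
  by rewrite mulrDl expRD subrr.
move/cvgrPdist_le/(_ _ e3x) : h3 => h3.
move: h1 h2 h3; apply: filterS3 => j h1 h2 h3.
have h3' := exp_psum_mul j X lM s0 t0 c0 hc.
have h2' := exp_psum_lipschitz j lM s0 c0 hc
  (exp_psum t M j X - exp_super t M X).
have lp := exp_psum_linear s j lM.
set A := exp_psum (s + t) M j X in h3' *.
set B := exp_psum s M j (exp_psum t M j X) in h3'.
have E : exp_psum s M j (exp_psum t M j X - exp_super t M X) =
    B - exp_psum s M j (exp_super t M X).
  by rewrite addrC -scaleN1r lp scaleN1r addrC.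
rewrite {}E in h2'; set D := exp_psum s M j (exp_super t M X) in h1 h2'.
have -> : A - exp_super s M (exp_super t M X) =
    ((B - D) + (D - exp_super s M (exp_super t M X))) - (B - A).
  by rewrite subrKA opprB [RHS]addrC subrKA.
apply: le_trans (tnB _ _) _.
rewrite (_ : e = e / 3 + e / 3 + e / 3); last by field.
apply: lerD; first apply: le_trans (tnD _ _) (lerD _ h1).
  apply: le_trans h2' _; apply: le_trans (ler_wpM2l (ltW K0) h2) _.
  by rewrite mulrC divfK // gt_eqF.
apply: le_trans h3' _; rewrite -/x.
rewrite sub0r normrN in h3; apply: le_trans (ler_wpM2r x0 (le_trans (ler_norm _) h3)) _.
by rewrite mulrAC ler_pdivrMr ?ltr_wpDl // ler_wpM2l ?ltW // ltrDl.
Qed.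

Lemma exp_super_iter d t (M : 'M[C]_d -> 'M[C]_d) k X : linear M -> 0 <= t ->
  exp_super (k%:R * t) M X = iter k (exp_super t M) X.
Proof.
move=> lM t0; elim: k => [|k IH]; first by rewrite mul0r exp_super0.
rewrite mulrS mulrDl mul1r exp_superD ?IH // mulr_ge0 //.
Qed.

(* e^{tM} = (e^{(t/n)M})^n has norm at most (1 + a (t/n)^2)^n, which tends to 1. *)
Lemma exp_super_contraction d (M : 'M[C]_d -> 'M[C]_d) (a t0 t : R) : linear M ->
  0 <= a -> 0 < t0 ->
  (forall s, 0 <= s <= t0 -> dbound (exp_super s M) (1 + a * s ^+ 2)) ->
  0 <= t -> dbound (exp_super t M) 1.
Proof.
move=> lM a0 t00 h tge0 X; rewrite mul1r; apply: le_add_eps => e e0.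
pose x := trace_norm X; have x0 : 0 <= x := tn_ge0 X.
pose e' := e / (x + 1); have e'0 : 0 < e' by rewrite divr_gt0 // ltr_wpDl.
(* Chosen so that 1 - del is the inverse of 1 + e'; then e^(-del) >= 1 - del gives e^del <= 1 +
   e'. *)
pose del := e' / (1 + e').
have del0 : 0 < del by rewrite divr_gt0 // addr_gt0.
(* The sum serves two demands at once: the substep t / (n+1) is at most t0, and the accumulated
   excess a t^2 / (n+1) is at most [del]. *)
have [n hn] : exists n : nat, t / t0 + a * t ^+ 2 / del <= n.+1%:R.
  exists (Num.truncn (t / t0 + a * t ^+ 2 / del)); apply: ltW; exact: truncnS_gt.
have n0 : 0 < n.+1%:R :> R by [].
have p1 : 0 <= t / t0 by rewrite divr_ge0 // ltW.
have p2 : 0 <= a * t ^+ 2 / del by rewrite divr_ge0 ?(ltW del0) // mulr_ge0 ?sqr_ge0.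
pose s := t / n.+1%:R.
have s0 : 0 <= s by rewrite divr_ge0.
have st0 : s <= t0.
  by rewrite ler_pdivrMr // mulrC -ler_pdivrMr //; lra.
have hs : dbound (iter n.+1 (exp_super s M)) ((1 + a * s ^+ 2) ^+ n.+1).
  apply: dbound_iter; last by apply: h; rewrite s0.
  by rewrite addr_ge0 // mulr_ge0 // sqr_ge0.
have -> : tens_id (exp_super t M) X = tens_id (iter n.+1 (exp_super s M)) X.
  apply: eq_tens_id => Y; rewrite -exp_super_iter //; congr (exp_super _ _ _).
  by rewrite mulrC divfK // gt_eqF.
apply: le_trans (hs X) _; rewrite -/x.
have b1 : (1 + a * s ^+ 2) ^+ n.+1 <= expR del.
  apply: (@le_trans _ _ (expR (a * s ^+ 2) ^+ n.+1)).
    apply: lerXn2r; rewrite ?nnegrE ?expR_ge0 ?expR_ge1Dx //.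
    by rewrite addr_ge0 // mulr_ge0 // sqr_ge0.
  rewrite -expRM_natl ler_expR /s exprMn exprVn.
  have -> : n.+1%:R * (a * (t ^+ 2 / n.+1%:R ^+ 2)) = a * t ^+ 2 / n.+1%:R :> R.
    by field; rewrite gt_eqF.
  rewrite ler_pdivrMr // [leRHS]mulrC -ler_pdivrMr //; lra.
have b2 : expR del <= 1 + e'.
  have := expR_ge1Dx (- del); rewrite expRN.
  have -> : 1 + - del = (1 + e')^-1.
    by rewrite /del; field; rewrite gt_eqF // addr_gt0.
  by rewrite lef_pV2 ?posrE ?expR_gt0 // addr_gt0.
apply: le_trans (ler_wpM2r x0 (le_trans b1 b2)) _.
rewrite mulrDl mul1r lerD2l /e' mulrAC ler_pdivrMr ?ltr_wpDl //.
by rewrite ler_wpM2l ?ltW // ltrDl.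
Qed.

End ExponentialTheory.

(* [t2 a (r x) + e x] collects the terms of degree at least 3 of the product of
   the three second order expansions. The identity is tested against a
   functional [f] so as to become one between scalars. *)
Lemma strang_identity (K : numFieldType) (V : lmodType K) (a b : V -> V)
    (f : V -> K) (z : K) (x : V) :
  let h v : V := z *: v in
  let c v := a v + a v + b v in
  let t2 n v : V := v + (n v + h (n (n v))) in
  let s1 v := a v + b v in
  let s2 v := h (a (a v)) + b (a v) + h (b (b v)) in
  let r v := b (h (a (a v))) + h (b (b (a v + h (a (a v))))) in
  let e v := a (s2 v) + h (a (a (s1 v + s2 v))) in
  {morph a : u v / u + v} -> {morph b : u v / u + v} ->
  (forall v, a (h v) = h (a v)) -> (forall v, b (h v) = h (b v)) ->
  {morph f : u v / u + v} -> (forall v, f (h v) = z * f v) -> z = 2^-1 ->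
  f (t2 a (t2 b (t2 a x))) = f (t2 c x) + f (t2 a (r x) + e x).
Proof.
move=> h c t2 s1 s2 r e aD bD aZ bZ fD fZ zE; rewrite /t2 /e /r /s1 /s2 /c.
rewrite !(aD, bD, aZ, bZ).
have hD u v : h (u + v) = h u + h v by rewrite /h scalerDr.
rewrite !(aD, bD, aZ, bZ, hD, fD, fZ).
by rewrite zE; field.
Qed.

(** * Third-order error of the symmetric splitting, and accumulation over the steps *)

Section Splitting.
Variable R : realType.
Local Notation C := R[i].
Local Notation rc := (real_complex R).

(** 5/2 is 1 + y + y^2/2 at y = 1. With the truncation error 1/3 added and rounded up, it becomes
    the 3 of [near_taylor2_dbound]. *)
Lemma taylor2_dbound d (N : 'M[C]_d -> 'M[C]_d) y : 0 <= y <= 1 ->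
  dbound N y -> dbound (taylor2 N) (5 / 2).
Proof.
move=> /andP[y0 y1] hN.
have h2 : 0 <= 2^-1 :> R by [].
have h := dboundD (@dbound_id R d)
  (dboundD hN (dboundZr h2 (dbound_comp y0 hN hN))).
apply: dbound_le h; nra.
Qed.

Lemma near_taylor2_dbound d (N E : 'M[C]_d -> 'M[C]_d) y : 0 <= y <= 1 ->
  dbound N y -> dbound (E \- taylor2 N) (y ^+ 3 / 3) -> dbound E 3.
Proof.
move=> y01 hN hE; have /andP[y0 y1] := y01.
have h := dboundD hE (taylor2_dbound y01 hN).
apply: (@eq_dbound _ _ _ ((E \- taylor2 N) \+ taylor2 N)) => [X|].
  by rewrite /= subrK.
have y3 : y ^+ 3 <= 1 by rewrite exprn_ile1.
apply: dbound_le h; lra.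
Qed.

Lemma taylor2_linear d (N : {linear 'M[C]_d -> 'M[C]_d}) : linear (taylor2 N).
Proof.
move=> z X Y; rewrite /taylor2 !(linearD, linearZ) /=.
by apply/matrixP => i j; rewrite !mxE; ring.
Qed.

Lemma linear_sub d (F : 'M[C]_d -> 'M[C]_d) : linear F -> {morph F : U V / U - V}.
Proof. by move=> lF U V; rewrite addrC -scaleN1r lF scaleN1r addrC. Qed.

(** Telescoping: F1 F2 F3 - G1 G2 G3 = (F1 - G1) F2 F3 + G1 (F2 - G2) F3 + G1 G2 (F3 - G3). *)
Lemma comp3_dbound d (F1 F2 F3 G1 G2 G3 : 'M[C]_d -> 'M[C]_d)
    (f2 f3 g1 g2 e1 e2 e3 : R) :
  linear G1 -> linear G2 -> 0 <= g1 -> 0 <= g2 -> 0 <= e1 -> 0 <= e2 -> 0 <= f2 ->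
  dbound F2 f2 -> dbound F3 f3 -> dbound G1 g1 -> dbound G2 g2 ->
  dbound (F1 \- G1) e1 -> dbound (F2 \- G2) e2 -> dbound (F3 \- G3) e3 ->
  dbound ((F1 \o (F2 \o F3)) \- (G1 \o (G2 \o G3)))
    (e1 * (f2 * f3) + g1 * (e2 * f3) + g1 * (g2 * e3)).
Proof.
move=> l1 l2 g10 g20 e10 e20 f20 hF2 hF3 hG1 hG2 h1 h2 h3.
have B1 := dbound_comp e10 h1 (dbound_comp f20 hF2 hF3).
have B2 := dbound_comp g10 hG1 (dbound_comp e20 h2 hF3).
have B3 := dbound_comp g10 hG1 (dbound_comp g20 hG2 h3).
apply: eq_dbound _ (dboundD (dboundD B1 B2) B3) => X /=.
by rewrite (linear_sub l2) !(linear_sub l1) !subrKA.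
Qed.

Lemma strang_taylor d (A B : {linear 'M[C]_d -> 'M[C]_d}) y : 0 <= y <= 1 ->
  dbound A y -> dbound B y ->
  dbound ((taylor2 A \o (taylor2 B \o taylor2 A)) \-
          taylor2 (fun X => A X + A X + B X)) (8 * y ^+ 3).
Proof.
move=> y01 hA hB; have /andP[y0 y1] := y01.
have h0 : 0 <= 2^-1 :> R by [].
have yy : 0 <= y * y by rewrite mulr_ge0.
have hAA := dboundZr h0 (dbound_comp y0 hA hA).
have hBB := dboundZr h0 (dbound_comp y0 hB hB).
have hBA := dbound_comp y0 hB hA.
have hh0 : 0 <= 2^-1 * (y * y) by rewrite mulr_ge0.
have hR := dboundD (dbound_comp y0 hB hAA) (dbound_comp hh0 hBB (dboundD hA hAA)).
have hPR := dbound_comp (a := 5 / 2) (divr_ge0 (ler0n R 5) (ler0n R 2))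
  (taylor2_dbound y01 hA) hR.
have hS1 := dboundD hA hB.
have hS2 := dboundD (dboundD hAA hBA) hBB.
have hE := dboundD (dbound_comp y0 hA hS2) (dbound_comp hh0 hAA (dboundD hS1 hS2)).
(* The bounds were assembled in the shape of the remainder [t2 a (r x) + e x] of [strang_identity],
   so that [b] evaluates to a polynomial in y, at most 57/8 y^3. *)
have := dboundD hPR hE.
set b := (X in dbound _ X -> _) => hb.
apply: (@eq_dbound _ _ _ _ _ _ (dbound_le _ hb)) => [X|].
  have AZ (U : 'M[C]_d) : A (rc 2^-1 *: U) = rc 2^-1 *: A U by exact: linearZ.
  have BZ (U : 'M[C]_d) : B (rc 2^-1 *: U) = rc 2^-1 *: B U by exact: linearZ.
  (* Matrix entries are the functionals against which the identity is tested. *)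
  apply/eqP; rewrite subr_eq; apply/eqP/matrixP => i j.
  rewrite [RHS]mxE addrC.
  have AD : {morph A : U V / U + V} by exact: linearD.
  have BD : {morph B : U V / U + V} by exact: linearD.
  refine (@strang_identity C 'M[C]_d A B (fun U => U i j) (rc 2^-1) X AD BD AZ BZ
    _ _ _) => [U V|U|].
  - by rewrite mxE.
  - by rewrite mxE.
  - by rewrite fmorphV rmorph_nat.
have y3 : 0 <= y ^+ 3 by rewrite exprn_ge0.
have y4 : y ^+ 4 <= y ^+ 3 by rewrite exprS ler_piMl.
have -> : b = 11 / 2 * y ^+ 3 + 13 / 8 * y ^+ 4 by rewrite /b; field.
lra.
Qed.

(** In units of y^3: replacing the three exponentials by truncations costs 91/12, multiplying the
    truncations 8, and truncating [EZ], of norm parameter 2 y, 8/3. The constant 20 rounds up the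
    sum. *)
Lemma strang d (A B : {linear 'M[C]_d -> 'M[C]_d})
    (EA EB EZ : 'M[C]_d -> 'M[C]_d) y : 0 <= y <= 1 ->
  dbound A y -> dbound B y ->
  dbound (EA \- taylor2 A) (y ^+ 3 / 3) ->
  dbound (EB \- taylor2 B) (y ^+ 3 / 3) ->
  dbound (EZ \- taylor2 (fun X => A X + A X + B X)) ((2 * y) ^+ 3 / 3) ->
  dbound ((EA \o (EB \o EA)) \- EZ) (20 * y ^+ 3).
Proof.
move=> y01 hA hB hEA hEB hEZ; have /andP[y0 y1] := y01.
have y3 : 0 <= y ^+ 3 by rewrite exprn_ge0.
have y33 : 0 <= y ^+ 3 / 3 by rewrite divr_ge0.
have p52 : 0 <= 5 / 2 :> R by [].
have h1 := comp3_dbound (taylor2_linear A) (taylor2_linear B) p52 p52 y33 y33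
  (ler0n R 3) (near_taylor2_dbound y01 hB hEB) (near_taylor2_dbound y01 hA hEA)
  (taylor2_dbound y01 hA) (taylor2_dbound y01 hB) hEA hEB hEA.
have h2 := dboundB (dboundD h1 (strang_taylor y01 hA hB)) hEZ.
apply: (@eq_dbound _ _ _ _ _ _ (dbound_le _ h2)) => [X|].
  by rewrite /= opprB !subrKA.
rewrite exprMn; lra.
Qed.

(** F^(k+1) - G^(k+1) = F (F^k - G^k) + (F - G) G^k; contractivity of both maps makes the errors add
    instead of compounding. *)
Lemma dbound_iterB d (F G : 'M[C]_d -> 'M[C]_d) e k : linear F -> 0 <= e ->
  dbound F 1 -> dbound G 1 -> dbound (F \- G) e ->
  dbound (iter k F \- iter k G) (k%:R * e).
Proof.
move=> lF e0 hF hG hFG; elim: k => [|k IH].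
  by rewrite mul0r; apply: eq_dbound _ (@dbound0 _ d) => X; rewrite /= subrr.
have hGk : dbound (iter k G) 1.
  by have := dbound_iter k ler01 hG; rewrite expr1n.
have h := dboundD (dbound_comp ler01 hF IH) (dbound_comp e0 hFG hGk).
apply: (@eq_dbound _ _ _ _ _ _ (dbound_le _ h)) => [X|]; last by rewrite mulrS; lra.
by rewrite /= (linear_sub lF) subrKA.
Qed.

End Splitting.

(** * Contractivity of Lindblad semigroups *)

Section Lindblad.
Variable R : realType.
Local Notation C := R[i].
Local Notation rc := (real_complex R).

Lemma adjZ m n (z : C) (A : 'M[C]_(m, n)) : (z *: A)^t* = Num.conj z *: A^t*.
Proof. by apply/matrixP => i j; rewrite !mxE rmorphM. Qed.

Lemma adjD m n (A B : 'M[C]_(m, n)) : (A + B)^t* = A^t* + B^t*.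
Proof. by apply/matrixP => i j; rewrite !mxE rmorphD. Qed.

Lemma adjN m n (A : 'M[C]_(m, n)) : (- A)^t* = - A^t*.
Proof. by apply/matrixP => i j; rewrite !mxE rmorphN. Qed.

Lemma conj_i : Num.conj ('i)%C = - ('i)%C :> C.
Proof. by apply/eqP; rewrite eq_complex /= oppr0 !eqxx. Qed.

Lemma hamiltonian_linear d (H : 'M[C]_d) : linear (hamiltonian_part H).
Proof.
have gen w z (P P' Q Q' : 'M[C]_d) : w *: ((z *: P + P') - (z *: Q + Q')) =
    z *: (w *: (P - Q)) + w *: (P' - Q').
  by apply/matrixP => i j; rewrite !mxE; ring.
move=> z X Y; rewrite /hamiltonian_part mulmxDr mulmxDl -scalemxAr -scalemxAl.
exact: gen.
Qed.

Lemma dissipative_linear d m (L : 'I_m -> 'M[C]_d) :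
  linear (dissipative_part L).
Proof.
move=> z X Y; rewrite /dissipative_part scaler_sumr -big_split.
apply: eq_bigr => mu _; set S := (L mu)^t* *m L mu.
have gen (P P' Q Q' : 'M[C]_d) : z *: P + P' - 2^-1 *: (z *: Q + Q') =
    z *: (P - 2^-1 *: Q) + (P' - 2^-1 *: Q').
  by apply/matrixP => i j; rewrite !mxE; ring.
rewrite !mulmxDr !mulmxDl -!scalemxAr -!scalemxAl addrACA -scalerDr.
exact: gen.
Qed.

Lemma lindbladian_linear d m (H : 'M[C]_d) (L : 'I_m -> 'M[C]_d) :
  linear (lindbladian H L).
Proof.
move=> z X Y; rewrite /lindbladian hamiltonian_linear dissipative_linear.
by rewrite scalerDr addrACA.
Qed.

Lemma mul_adj_linear d (J : 'M[C]_d) : linear (fun X => J *m X *m J^t*).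
Proof. by move=> z X Y; rewrite mulmxDr mulmxDl -scalemxAr -scalemxAl. Qed.

Lemma nrm2_bounded d (J : 'M[C]_d) :
  exists2 c, 0 <= c & forall u, nrm2 (J *m u) <= c * nrm2 u.
Proof.
pose M := J^t* *m J.
exists (\sum_i \sum_j cabs (M i j)).
  by do 2!(apply: sumr_ge0 => ? _); exact: cabs_ge0.
move=> u; rewrite nrm2_adj -/M ripE.
have -> : rtr (M *m u *m u^t*) = \sum_i \sum_j complex.Re (M i j * (u *m u^t*) j i).
  rewrite -mulmxA /rtr /mxtrace Re_sum; apply: eq_bigr => i _.
  by rewrite mxE Re_sum.
have tu : trace_norm (u *m u^t*) <= nrm2 u by have := tn_rank1 u u; lra.
rewrite mulr_suml; apply: ler_sum => i _; rewrite mulr_suml; apply: ler_sum => j _.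
apply: le_trans (ler_norm _) (le_trans (normRe_le_cabs _) _).
rewrite /cabs normrM !cabsE Re_rcM ler_wpM2l ?cabs_ge0 //.
exact: le_trans (entry_le_tn (u *m u^t*) j i) tu.
Qed.

(* With J = iH + (1/2) sum L^* L, the map X + sL(X) differs by s^2 J X J^* from
   the map with Kraus operators 1 - sJ and sqrt(s) L_mu, which preserves the
   trace up to order s^2. *)
Lemma lindblad_euler_dbound d m (H : 'M[C]_d) (L : 'I_m -> 'M[C]_d) : H^t* = H ->
  exists2 c, 0 <= c & forall s, 0 <= s ->
    dbound (fun X => X + rc s *: lindbladian H L X) (1 + c * s ^+ 2).
Proof.
move=> HH; pose S := \sum_mu (L mu)^t* *m L mu.
pose J : 'M[C]_d := ('i)%C *: H + rc 2^-1 *: S.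
have SS : S^t* = S.
  rewrite /S raddf_sum map_mx_sum; apply: eq_bigr => mu _.
  by rewrite -/(_^t*) adjM trmxCK.
have [c1 c10 hc1] := nrm2_bounded J.
have [c2 c20 hc2] := linear_dbound (mul_adj_linear J).
exists (c1 + c2) => [|s s0]; first exact: addr_ge0.
pose K (a : option 'I_m) : 'M[C]_d :=
  if a is Some mu then rc (Num.sqrt s) *: L mu else 1%:M - rc s *: J.
have SU u : rip u (S *m u) = \sum_mu nrm2 (L mu *m u).
  rewrite /S mulmx_suml ripE mulmx_suml rtr_sum; apply: eq_bigr => mu _.
  by rewrite -ripE nrm2_adj.
(* iH is antihermitian and drops out of the real part. What remains makes the first-order loss in |u
   - s J u|^2 cancel the gain from the jump operators. *)
have JU u : 2 * rip u (J *m u) = \sum_mu nrm2 (L mu *m u).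
  rewrite mulmxDl ripDr -SU.
  have -> : rip u ((('i)%C *: H) *m u) = 0.
    have e : (('i)%C *: H)^t* = - (('i)%C *: H).
      by rewrite adjZ HH conj_i scaleNr.
    have := rip_adj (('i)%C *: H) u u.
    by rewrite e mulNmx [RHS]ripC ripNr; lra.
  rewrite ripE -!scalemxAl rtrZ -ripE; lra.
have kb : dbound (fun X => \sum_a K a *m X *m (K a)^t*) (1 + c1 * s ^+ 2).
  apply: dbound_kraus => [|u]; first by rewrite addr_ge0 // mulr_ge0 // sqr_ge0.
  rewrite big_option /= mulmxBl mul1mx nrm2B -scalemxAl nrm2Z cabs_rc ger0_norm //.
  have -> : rip u (rc s *: (J *m u)) = s * rip u (J *m u).
    by rewrite ripE -scalemxAl rtrZ -ripE.
  have -> : \sum_mu nrm2 (rc (Num.sqrt s) *: L mu *m u) = s * (2 * rip u (J *m u)).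
    rewrite JU mulr_sumr; apply: eq_bigr => mu _.
    by rewrite -scalemxAl nrm2Z cabs_rc real_normK ?num_real // sqr_sqrtr.
  have := ler_wpM2l (sqr_ge0 s) (hc1 u).
  move: (nrm2 u) (nrm2 (J *m u)) (rip u (J *m u)) => a b e; lra.
have h := dboundB kb (dboundZr (sqr_ge0 s) hc2).
apply: (@eq_dbound _ _ _ _ _ _ (dbound_le _ h)) => [X|]; last by lra.
rewrite /= big_option /=.
have -> : \sum_mu (rc (Num.sqrt s) *: L mu) *m X *m (rc (Num.sqrt s) *: L mu)^t* =
    rc s *: \sum_mu L mu *m X *m (L mu)^t*.
  rewrite scaler_sumr; apply: eq_bigr => mu _.
  rewrite adjZ conj_rc -!scalemxAl -scalemxAr scalerA.
  by rewrite -rmorphM -expr2 sqr_sqrtr.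
have JE : J *m X + X *m J^t* =
    ('i)%C *: (H *m X - X *m H) + rc 2^-1 *: (S *m X + X *m S).
  have -> : J^t* = - (('i)%C *: H) + rc 2^-1 *: S.
    by rewrite /J adjD !adjZ HH SS conj_rc conj_i scaleNr.
  rewrite /J mulmxDl mulmxDr mulmxN -!scalemxAl -!scalemxAr addrACA.
  by rewrite -scalerBr -scalerDr.
have -> : lindbladian H L X =
    \sum_mu L mu *m X *m (L mu)^t* - (J *m X + X *m J^t*).
  have h2 : rc 2^-1 = 2^-1 by rewrite fmorphV rmorph_nat.
  rewrite JE h2 /lindbladian /hamiltonian_part /dissipative_part.
  rewrite sumrB -scaler_sumr big_split /= -mulmx_suml -mulmx_sumr -/S.
  by rewrite scaleNr opprD addrCA.
have -> : (1%:M - rc s *: J)^t* = 1%:M - rc s *: J^t*.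
  by rewrite adjD adjN adj1 adjZ conj_rc.
rewrite mulmxBl mul1mx mulmxBr mulmx1 !mulmxBl -!scalemxAl -!scalemxAr.
rewrite scalerA -rmorphM -expr2 /=.
have gen w w' (Y0 Y1 Y2 Y3 Y4 : 'M[C]_d) : Y0 + w *: (Y4 - (Y1 + Y2)) =
    Y0 - w *: Y1 - (w *: Y2 - w' *: Y3) + w *: Y4 - w' *: Y3.
  by apply/matrixP => i j; rewrite !mxE; ring.
exact: gen.
Qed.

Lemma lindblad_contraction d m (H : 'M[C]_d) (L : 'I_m -> 'M[C]_d) t :
  H^t* = H -> 0 <= t -> dbound (exp_super t (lindbladian H L)) 1.
Proof.
move=> HH; have lL := lindbladian_linear H L.
have [c c0 hc] := lindblad_euler_dbound L HH.
have [x x0 hx] := linear_dbound lL.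
(* For s <= 1 / (x + 1) one has s x <= 1, so the cubic Taylor remainder is also O(s^2); the added 1
   covers x = 0. *)
have x1 : 0 < x + 1 by rewrite ltr_wpDl.
have t0 : 0 < (x + 1)^-1 by rewrite invr_gt0.
apply: (@exp_super_contraction _ _ _ (c + x ^+ 2) _ _ lL _ t0) => [|s].
  by rewrite addr_ge0 // sqr_ge0.
move=> /andP[s0 st].
have sx : s * x <= 1.
  apply: le_trans (ler_wpM2r x0 st) _.
  by rewrite mulrC ler_pdivrMr // mul1r lerDl.
have sx0 : 0 <= s * x by rewrite mulr_ge0.
have h1 := exp_taylor2 lL s0 x0 hx (le_trans sx (ler1n R 2)).
have hsL := dboundZr s0 hx.
have p2 : 0 <= 2^-1 :> R by [].
have h2 := dboundZr p2 (dbound_comp sx0 hsL hsL).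
have h := dboundD h1 (dboundD (hc s s0) h2).
apply: (@eq_dbound _ _ _ _ _ _ (dbound_le _ h)) => [X|].
  by rewrite /= /taylor2 -(addrA X (rc s *: _)) subrK.
have : (s * x) ^+ 3 <= (s * x) ^+ 2 by rewrite exprS ler_piMl // sqr_ge0.
have := sqr_ge0 (s * x); rewrite !expr2; lra.
Qed.

End Lindblad.

(** * Bounding both parts of the generator by the Pauli norm *)

Section PauliBounds.
Variable R : realType.
Local Notation C := R[i].
Local Notation rc := (real_complex R).

Lemma unitary_adj_contr d (U : 'M[C]_d) : U \is unitarymx -> contr (U^t*).
Proof. by move=> uU; apply: unitary_contr; rewrite trmxC_unitary. Qed.

(** One-sided products by a Pauli sum are instances too: a family with the single member 1 stands
    for the missing factor. *)
Lemma contr_sum_mul_dbound d (I J : finType) (a : I -> R) (b : J -> R)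
    (U : I -> 'M[C]_d) (V : J -> 'M[C]_d) :
  (forall i, 0 <= a i) -> (forall j, 0 <= b j) ->
  (forall i, contr (U i)) -> (forall j, contr (V j)) ->
  dbound (fun X => (\sum_i rc (a i) *: U i) *m X *m (\sum_j rc (b j) *: V j)^t*)
    ((\sum_i a i) * \sum_j b j).
Proof.
move=> a0 b0 cU cV.
have h : dbound (fun X => \sum_i \sum_j rc (a i * b j) *: (U i *m X *m (V j)^t*))
    (\sum_i \sum_j a i * b j * 1).
  apply: dbound_sum => i _; apply: dbound_sum => j _.
  by apply: dboundZr; [exact: mulr_ge0 | exact: dbound_contr2].
have -> : (\sum_i a i) * (\sum_j b j) = \sum_i \sum_j a i * b j * 1.
  rewrite mulr_suml; apply: eq_bigr => i _.
  by rewrite mulr_sumr; apply: eq_bigr => j _; rewrite mulr1.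
apply: eq_dbound _ h => X.
have -> : (\sum_j rc (b j) *: V j)^t* = \sum_j rc (b j) *: (V j)^t*.
  rewrite raddf_sum map_mx_sum; apply: eq_bigr => j _.
  by rewrite adjZ conj_rc.
rewrite !mulmx_suml; apply: eq_bigr => i _.
rewrite mulmx_sumr; apply: eq_bigr => j _.
by rewrite -!scalemxAl -scalemxAr scalerA rmorphM.
Qed.

Lemma unitary_tens m n (U : 'M[C]_m) (V : 'M[C]_n) :
  U \is unitarymx -> V \is unitarymx -> U *t V \is unitarymx.
Proof.
move=> /unitarymxP hU /unitarymxP hV; apply/unitarymxP.
rewrite adj_tens tensmx_mul hU hV; apply/matrixP => x y.
case: (mxtens_indexP x) => i a; case: (mxtens_indexP y) => j b.
by rewrite tensmxE !mxE (can_eq (@mxtens_indexK m n)) xpair_eqE -mulnb natrM.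
Qed.

Lemma pauli_mx_unitary p : pauli_mx R p \is unitarymx.
Proof.
have ii : ('i : C)%C * ('i)%C = -1 by rewrite -expr2 sqr_i.
apply/unitarymxP/matrixP => i j; rewrite !mxE !big_ord_recl big_ord0 !mxE.
have o i' : i' = 0 \/ i' = lift ord0 ord0 :> 'I_2.
  by case: i' => [[|[|//]] hi]; [left | right]; apply: val_inj.
case: p; case: (o i) => ->; case: (o j) => -> /=;
  rewrite ?conj_i ?rmorphN ?rmorph1 ?rmorph0 /= ?conj_i ?mulNr ?mulrN ?ii; ring.
Qed.

Lemma castmx_unitary m n (e : m = n) (U : 'M[C]_m) :
  U \is unitarymx -> castmx (e, e) U \is unitarymx.
Proof. by case: n / e. Qed.

Lemma pauli_tensor_unitary n (w : n.-tuple pauli) :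
  pauli_tensor R w \is unitarymx.
Proof.
elim: n w => [|n IH] w /=; first by apply/unitarymxP; rewrite adj1 mulmx1.
apply: castmx_unitary; apply: unitary_tens; [exact: pauli_mx_unitary | exact: IH].
Qed.

Lemma phase_unitary d (z : C) (U : 'M[C]_d) : `|z| = 1 ->
  U \is unitarymx -> z *: U \is unitarymx.
Proof.
move=> z1 /unitarymxP hU; apply/unitarymxP.
by rewrite adjZ -scalemxAl -scalemxAr hU scalerA -normCK z1 expr1n scale1r.
Qed.

Section Bounds.
Variables (n s : nat).

Definition pauli_weight (P : pauli_sum R n s) : R := \sum_k pauli_coef P k.

Lemma pauli_weight_ge0 P : 0 <= pauli_weight P.
Proof. by apply: sumr_ge0 => k _; rewrite ltW // pauli_coef_gt0. Qed.

Let V (P : pauli_sum R n s) k := pauli_phase P k *: pauli_tensor R (pauli_word P k).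

Let V_unitary P k : V P k \is unitarymx.
Proof.
exact: phase_unitary (pauli_phase_norm P k) (pauli_tensor_unitary _).
Qed.

Let coef0 (P : pauli_sum R n s) k : 0 <= pauli_coef P k :> R.
Proof. by rewrite ltW // pauli_coef_gt0. Qed.

Let one (A : 'M[C]_(2 ^ n)) : \sum_(i < 1) rc 1 *: A = A.
Proof. by rewrite big_ord1 scale1r. Qed.

Let sum1 : \sum_(i < 1) 1 = 1 :> R.
Proof. by rewrite big_ord1. Qed.

Lemma pauli_conj_dbound P :
  dbound (fun X => pauli_op P *m X *m (pauli_op P)^t*) (pauli_weight P ^+ 2).
Proof.
apply: (contr_sum_mul_dbound (U := V P) (V := V P)) => // k;
  exact/unitary_contr/V_unitary.
Qed.

Lemma pauli_mull_dbound P :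
  dbound (fun X => pauli_op P *m X) (pauli_weight P).
Proof.
have := contr_sum_mul_dbound (a := pauli_coef P) (b := fun _ : 'I_1 => 1)
  (U := V P) (V := fun=> 1%:M) (coef0 P) (fun=> ler01)
  (fun k => unitary_contr (V_unitary P k)) (fun=> @contr1 R _).
rewrite sum1 mulr1; apply: eq_dbound => X.
by rewrite one adj1 mulmx1.
Qed.

Lemma pauli_mulr_adj_dbound P :
  dbound (fun X => X *m (pauli_op P)^t*) (pauli_weight P).
Proof.
have := contr_sum_mul_dbound (a := fun _ : 'I_1 => 1) (b := pauli_coef P)
  (U := fun=> 1%:M) (V := V P) (fun=> ler01) (coef0 P) (fun=> @contr1 R _)
  (fun k => unitary_contr (V_unitary P k)).
rewrite sum1 mul1r; apply: eq_dbound => X.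
by rewrite one mul1mx.
Qed.

Lemma pauli_adj_mull_dbound P :
  dbound (fun X => (pauli_op P)^t* *m X) (pauli_weight P).
Proof.
have E : (pauli_op P)^t* = \sum_k rc (pauli_coef P k) *: (V P k)^t*.
  rewrite raddf_sum map_mx_sum; apply: eq_bigr => k _.
  by rewrite adjZ conj_rc.
have := contr_sum_mul_dbound (a := pauli_coef P) (b := fun _ : 'I_1 => 1)
  (U := fun k => (V P k)^t*) (V := fun=> 1%:M) (coef0 P) (fun=> ler01)
  (fun k => unitary_adj_contr (V_unitary P k)) (fun=> @contr1 R _).
rewrite sum1 mulr1; apply: eq_dbound => X.
by rewrite one adj1 mulmx1 E.
Qed.

Lemma pauli_mulr_dbound P :
  dbound (fun X => X *m pauli_op P) (pauli_weight P).
Proof.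
have E : pauli_op P = (\sum_k rc (pauli_coef P k) *: (V P k)^t*)^t*.
  rewrite raddf_sum map_mx_sum; apply: eq_bigr => k _.
  by rewrite adjZ conj_rc trmxCK.
have := contr_sum_mul_dbound (a := fun _ : 'I_1 => 1) (b := pauli_coef P)
  (U := fun=> 1%:M) (V := fun k => (V P k)^t*) (fun=> ler01) (coef0 P)
  (fun=> @contr1 R _) (fun k => unitary_adj_contr (V_unitary P k)).
rewrite sum1 mul1r; apply: eq_dbound => X.
by rewrite one mul1mx {1}E.
Qed.

Lemma hamiltonian_dbound P :
  dbound (hamiltonian_part (pauli_op P)) (2 * pauli_weight P).
Proof.
have := dboundZ (- ('i)%C) (dboundB (pauli_mull_dbound P) (pauli_mulr_dbound P)).
have -> : cabs (- ('i)%C : C) = 1.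
  by rewrite /cabs normrN normc_def /= expr0n expr1n add0r sqrtr1.
by rewrite mul1r mulrDl mul1r.
Qed.

(** For a jump operator of weight w, the term L X L^* costs w^2 and the anticommutator half of 2
    w^2; hence the squares in the Pauli norm. *)
Lemma dissipative_dbound m (P : 'I_m -> pauli_sum R n s) (L : 'I_m -> 'M[C]_(2 ^ n)) :
  (forall mu, L mu = pauli_op (P mu)) ->
  dbound (dissipative_part L) (2 * \sum_mu pauli_weight (P mu) ^+ 2).
Proof.
move=> LE; rewrite mulr_sumr; apply: dbound_sum => mu _; rewrite LE.
set w := pauli_weight _; set A := pauli_op _.
have w0 : 0 <= w := pauli_weight_ge0 _.
have h1 := pauli_conj_dbound (P mu).
have h2 := dbound_comp w0 (pauli_adj_mull_dbound (P mu)) (pauli_mull_dbound (P mu)).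
have h3 := dbound_comp w0 (pauli_mulr_dbound (P mu)) (pauli_mulr_adj_dbound (P mu)).
have h := dboundB h1 (dboundZ 2^-1 (dboundD h2 h3)).
apply: (@eq_dbound _ _ _ _ _ _ (dbound_le _ h)) => [X|].
  by rewrite /= !mulmxA.
have -> : 2^-1 = rc 2^-1 by rewrite fmorphV rmorph_nat.
rewrite cabs_rc ger0_norm // -/w; lra.
Qed.

End Bounds.
End PauliBounds.

(** * Averaging the compiled circuits *)

Section Compilation.
Variable R : realType.
Local Notation C := R[i].
Local Notation rc := (real_complex R).
Variables (d : nat) (S : stoch_sim R d) (K : 'M[C]_d -> 'M[C]_d).

Lemma run_circuit_linear c : linear K -> linear (run_circuit K c (S := S)).
Proof.
move=> lK; elim: c => [|[i|] c IH] z X Y //=;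
  rewrite /run_circuit /= -!/(run_circuit _ _ _).
  by rewrite oracle_linear IH.
by rewrite lK IH.
Qed.

Lemma averaged_channel_hamsim a X :
  averaged_channel S K (CallHamSim :: a) X = averaged_channel S K a (K X).
Proof. by rewrite /averaged_channel /= big_map. Qed.

(** The rest of the circuit is linear and its draws are independent of the first, so the first index
    may be averaged before the rest is run. *)
Lemma averaged_channel_sample a X : linear K ->
  averaged_channel S K (SampleOracle :: a) X =
  averaged_channel S K a (ss_channel S X).
Proof.
move=> lK; rewrite /averaged_channel /= big_allpairs_dep /= big_enum /=.
rewrite exchange_big /=; apply: eq_bigr => -[w c] _ /=.
pose f : {linear 'M[C]_d -> 'M[C]_d} := HB.pack (run_circuit K c (S := S))
  (GRing.isLinear.Build _ _ _ _ _ (run_circuit_linear c lK)).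
rewrite /ss_channel -[run_circuit K c _ in RHS]/(f _) linear_sum scaler_sumr.
apply: eq_bigr => i _; rewrite linearZ scalerA -rmorphM /= mulrC.
by [].
Qed.

Definition trotter_algorithm (k : nat) : algorithm :=
  flatten (nseq k [:: CallHamSim; SampleOracle; CallHamSim]).

Lemma size_trotter k : size (trotter_algorithm k) = (3 * k)%N.
Proof.
by elim: k => [|k IH] //; rewrite /trotter_algorithm /= -/(trotter_algorithm k) IH mulnS.
Qed.

Lemma averaged_trotter k X : linear K ->
  averaged_channel S K (trotter_algorithm k) X =
  iter k (K \o (ss_channel S \o K)) X.
Proof.
move=> lK; elim: k X => [|k IH] X.
  by rewrite /averaged_channel /= big_seq1 scale1r.
rewrite iterSr -IH /trotter_algorithm /= -/(trotter_algorithm k).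
by rewrite averaged_channel_hamsim averaged_channel_sample // averaged_channel_hamsim.
Qed.

End Compilation.

(** * Error of one step and choice of the number of steps *)

Section ErrorBudget.
Variable R : realType.
Local Notation C := R[i].
Local Notation rc := (real_complex R).

Lemma error_budget (c0 eps Q r y : R) :
  0 <= c0 -> 0 < eps -> 0 < r -> 0 <= Q -> 0 <= y -> y <= 2 * Q / r ->
  20 * (Num.sqrt ((1 + 6 * c0) / eps) * Q `^ (3 / 2)) <= r ->
  r * (10 * (20^-1 * (eps / r)) + (3 * c0 + 20) * y ^+ 3) <= eps.
Proof.
move=> c00 e0 r0 Q0 y0 yQ zr.
have c1 : 0 <= (1 + 6 * c0) / eps by rewrite divr_ge0 ?(ltW e0) //; lra.
have Q3 : (Q `^ (3 / 2)) ^+ 2 = Q ^+ 3.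
  by rewrite -powR_mulrn ?powR_ge0 // -powRrM divfK // powR_mulrn.
(* Squaring removes the square root and the exponent 3/2 together, leaving a rational inequality. *)
have zr2 : 400 * ((1 + 6 * c0) / eps * Q ^+ 3) <= r ^+ 2.
  have := sqr_sqrtr c1; have := sqrtr_ge0 ((1 + 6 * c0) / eps).
  move: zr Q3 (powR_ge0 Q (3 / 2)).
  move: (Num.sqrt _) (Q `^ (3 / 2)) => a b zr <- b0 a0 <-.
  have -> : 400 * (a ^+ 2 * b ^+ 2) = (20 * (a * b)) ^+ 2 by ring.
  apply: lerXn2r zr; rewrite nnegrE ?(ltW r0) //.
  by rewrite !mulr_ge0.
clear zr Q3; pose u := Q ^+ 3 / r ^+ 2.
have u0 : 0 <= u by rewrite divr_ge0 // exprn_ge0 // ltW.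
have hu : 400 * ((1 + 6 * c0) * u) <= eps.
  have -> : 400 * ((1 + 6 * c0) * u) =
      eps * (400 * ((1 + 6 * c0) / eps * Q ^+ 3) / r ^+ 2).
    by rewrite /u; field; rewrite !gt_eqF.
  apply: ler_piMr; first exact: ltW.
  by rewrite ler_pdivrMr ?mul1r //; exact: exprn_gt0.
have ry : r * y ^+ 3 <= 8 * u.
  have -> : 8 * u = r * (2 * Q / r) ^+ 3 by rewrite /u; field; rewrite gt_eqF.
  rewrite ler_wpM2l ?(ltW r0) // lerXn2r // nnegrE //.
  exact: le_trans y0 yQ.
have -> : r * (10 * (20^-1 * (eps / r)) + (3 * c0 + 20) * y ^+ 3) =
    eps / 2 + (3 * c0 + 20) * (r * y ^+ 3) by field; rewrite gt_eqF.
have h : (3 * c0 + 20) * (r * y ^+ 3) <= (3 * c0 + 20) * (8 * u).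
  by rewrite ler_wpM2l //; lra.
have := mulr_ge0 c00 u0; lra.
Qed.

(** Serves the degenerate case of zero steps, where the empty algorithm is the identity. It is the
    Taylor bound at norm 0, valid for every t. *)
Lemma exp_super_near_id d (M : 'M[C]_d -> 'M[C]_d) t : linear M -> 0 <= t ->
  dbound M 0 -> dbound (@id 'M[C]_d \- exp_super t M) 0.
Proof.
move=> lM t0 hM; have ty : t * 0 <= 2 by rewrite mulr0.
have p2 : 0 <= 2^-1 :> R by [].
have p0 : 0 <= t * 0 by rewrite mulr0.
have hTM := dboundZr t0 hM.
have h := dboundB (dbound0 (d := d)) (dboundD (exp_taylor2 lM t0 (lexx 0) hM ty)
    (dboundD hTM (dboundZr p2 (dbound_comp p0 hTM hTM)))).
apply: (@eq_dbound _ _ _ _ _ _ (dbound_le _ h)) => [X|].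
  have gen (Y Z : 'M[C]_d) : X - Y = 0 - (Y - (X + Z) + Z).
    by apply/matrixP => i j; rewrite !mxE; ring.
  exact: gen.
by rewrite mulr0 expr0n /=; lra.
Qed.

Lemma dbound_distC d (F G : 'M[C]_d -> 'M[C]_d) e :
  dbound (F \- G) e -> dbound (G \- F) e.
Proof.
move=> h; have := dboundZ (-1) h; rewrite /cabs normrN1 mul1r.
by apply: eq_dbound => X /=; rewrite scaleN1r opprB.
Qed.

(** In the telescoping the simulated maps have norm at most 1 and the exact exponentials at most 3:
    the two calls to [K] cost e and 9 e, the sampled oracle 3 c. The cubic term is the splitting
    error. *)
Lemma trotter_step d m (H : 'M[C]_d) (L : 'I_m -> 'M[C]_d) (S : stoch_sim R d)
    (K : 'M[C]_d -> 'M[C]_d) (h x t e c : R) :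
  quantum_channel K -> 0 <= h -> 0 <= x -> 0 <= t -> 0 <= e -> 0 <= c ->
  dbound (hamiltonian_part H) h -> dbound (dissipative_part L) x ->
  (h / 2 + x) * t <= 1 ->
  dbound (exp_super (t / 2) (hamiltonian_part H) \- K) e ->
  dbound (exp_super t (dissipative_part L) \- ss_channel S) c ->
  dbound ((K \o (ss_channel S \o K)) \- exp_super t (lindbladian H L))
    (10 * e + 3 * c + 20 * ((h / 2 + x) * t) ^+ 3).
Proof.
move=> qK h0 x0 t0 e0 c0 hH hD; set y := (_ + _) * _ => y1 hK hS.
have lH := hamiltonian_linear H; have lD := dissipative_linear L.
have lL := lindbladian_linear H L.
have y0 : 0 <= y by rewrite mulr_ge0 // addr_ge0 // divr_ge0.
have y01 : 0 <= y <= 1 by rewrite y0.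
have t20 : 0 <= t / 2 by rewrite divr_ge0.
have xt : 0 <= x * t by rewrite mulr_ge0.
have ht : 0 <= h * t by rewrite mulr_ge0.
have hA' := dboundZr t20 hH; have hB' := dboundZr t0 hD.
have lA : linear (fun X => rc (t / 2) *: hamiltonian_part H X).
  by move=> z X Y; rewrite lH (scale_linear (rc (t / 2))).
have lB : linear (fun X => rc t *: dissipative_part L X).
  by move=> z X Y; rewrite lD (scale_linear (rc t)).
pose A : {linear 'M[C]_d -> 'M[C]_d} := HB.pack
  (fun X => rc (t / 2) *: hamiltonian_part H X) (GRing.isLinear.Build _ _ _ _ _ lA).
pose B : {linear 'M[C]_d -> 'M[C]_d} := HB.pack
  (fun X => rc t *: dissipative_part L X) (GRing.isLinear.Build _ _ _ _ _ lB).
have yA : t / 2 * h <= y by rewrite /y; lra.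
have yB : t * x <= y by rewrite /y; lra.
have y3 a : 0 <= a -> a <= y -> a ^+ 3 / 3 <= y ^+ 3 / 3.
  by move=> a0 ay; rewrite ler_wpM2r // lerXn2r // nnegrE.
have hA : dbound A y := dbound_le yA hA'.
have hB : dbound B y := dbound_le yB hB'.
have hEA : dbound (exp_super (t / 2) (hamiltonian_part H) \- taylor2 A) (y ^+ 3 / 3).
  apply: dbound_le (exp_taylor2 lH t20 h0 hH _); last by lra.
  by apply: y3 => //; rewrite mulr_ge0.
have hEB : dbound (exp_super t (dissipative_part L) \- taylor2 B) (y ^+ 3 / 3).
  apply: dbound_le (exp_taylor2 lD t0 x0 hD _); last by lra.
  by apply: y3 => //; rewrite mulr_ge0.
have hEZ : dbound (exp_super t (lindbladian H L) \-
    taylor2 (fun X => A X + A X + B X)) ((2 * y) ^+ 3 / 3).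
  (* The joint exponential carries h rather than h / 2, which is why its norm parameter is 2 y, up
     to 2. *)
  have y2 : t * (h + x) <= 2 * y by rewrite /y; lra.
  have hx0 : 0 <= h + x by rewrite addr_ge0.
  have -> : (fun X => A X + A X + B X) = (fun X => rc t *: lindbladian H L X).
    apply/funext => V; rewrite /lindbladian scalerDr; congr (_ + _).
    by rewrite -scalerDl -rmorphD /= -splitr.
  have ty2 : t * (h + x) <= 2 by lra.
  apply: dbound_le (exp_taylor2 lL t0 hx0 (dboundD hH hD) ty2).
  rewrite ler_wpM2r //; apply: lerXn2r y2; rewrite nnegrE mulr_ge0 //.
have s1 := strang y01 hA hB hEA hEB hEZ.
have lEA := exp_super_linear (t / 2) lH; have lEB := exp_super_linear t lD.
have s2 := comp3_dbound lEA lEB (ler0n R 3) (ler0n R 3) e0 c0 ler01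
  (ss_channel_dbound S) (channel_dbound qK)
  (near_taylor2_dbound y01 hA hEA) (near_taylor2_dbound y01 hB hEB)
  (dbound_distC hK) (dbound_distC hS) (dbound_distC hK).
apply: (@eq_dbound _ _ _ _ _ _ (dbound_le _ (dboundD s2 s1))) => [X|]; last by lra.
by rewrite /= subrKA.
Qed.

End ErrorBudget.

Unset Implicit Arguments.

Theorem theorem1 (R : realType) :
  exists A B E : R, [/\ 0 < A, 0 < B & 0 < E] /\
  forall (n m s : nat) (H : 'MC[R]_(2 ^ n)) (L : 'I_m -> 'MC[R]_(2 ^ n))
    (PH : pauli_sum R n s) (PL : 'I_m -> pauli_sum R n s)
    (c0 : R) (N : R -> stoch_sim R (2 ^ n)) (T eps : R),
  H ^t* = H ->
  H = pauli_op PH ->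
  (forall mu, L mu = pauli_op (PL mu)) ->
  0 <= c0 ->
  (forall dt : R, 0 < dt ->
    (diamond_norm (hamiltonian_part H) / 2
      + diamond_norm (dissipative_part L)) * dt <= 1 ->
    diamond_norm (exp_super dt (dissipative_part L) \- ss_channel (N dt))
      <= c0 * (diamond_norm (dissipative_part L) * dt) ^+ 3) ->
  0 < T ->
  0 < eps ->
  let r : nat := `|Num.ceil (A * (Num.sqrt ((1 + 6 * c0) / eps)
                    * (pauli_norm PH PL * T) `^ (3 / 2)))|%N in
  let dt : R := T / r%:R in
  (diamond_norm (hamiltonian_part H) / 2
    + diamond_norm (dissipative_part L)) * dt <= 1 ->
  exists a : algorithm,
    (size a)%:R <= B * r%:R /\
    forall K : 'MC[R]_(2 ^ n) -> 'MC[R]_(2 ^ n),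
      quantum_channel K ->
      diamond_norm (exp_super (dt / 2) (hamiltonian_part H) \- K)
        <= E * (eps / r%:R) ->
      diamond_norm (averaged_channel (N dt) K a
        \- exp_super T (lindbladian H L)) <= eps.
Proof.
exists 20, 3, 20^-1; split; first by split; rewrite ?invr_gt0.
move=> n m s H L PH PL c0 N T eps HH HE LE c00 hN T0 eps0.
set P := pauli_norm PH PL; set z := 20 * _ => r dt.
set h := diamond_norm (hamiltonian_part H) in hN *.
set x := diamond_norm (dissipative_part L) in hN * => y1.
have d0 : (0 < 2 ^ n)%N by rewrite expn_gt0.
have lH := hamiltonian_linear H; have lD := dissipative_linear L.
have lL := lindbladian_linear H L.
have hH : dbound (hamiltonian_part H) h := diamond_dbound lH.
have hD : dbound (dissipative_part L) x := diamond_dbound lD.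
have h0 : 0 <= h := diamond_ge0 d0 lH.
have x0 : 0 <= x := diamond_ge0 d0 lD.
pose w := pauli_weight PH; pose v := \sum_mu pauli_weight (PL mu) ^+ 2.
have w0 : 0 <= w := pauli_weight_ge0 PH.
have v0 : 0 <= v by apply: sumr_ge0 => mu _; exact: sqr_ge0.
have PE : P = w + v by [].
have P0 : 0 <= P by rewrite PE addr_ge0.
have hw : h <= 2 * w.
  by apply: dbound_diamond => //; rewrite HE; exact: hamiltonian_dbound.
have xv : x <= 2 * v by apply: dbound_diamond => //; exact: dissipative_dbound.
have z0 : 0 <= z by rewrite !mulr_ge0 ?sqrtr_ge0 ?powR_ge0.
have zr : z <= r%:R.
  have cz : (0 <= Num.ceil z)%R by rewrite ceil_ge0; apply: lt_le_trans (ltrN10 R) z0.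
  by rewrite /r natr_absz ger0_norm // ceil_ge.
have dtE : dt = T / r%:R by [].
clearbody dt r h x P.
exists (trotter_algorithm r); split; first by rewrite size_trotter natrM.
move=> K qK hK; have lK := channel_linear qK.
apply: dbound_diamond => //.
have [r0|rpos] := posnP r.
  (* r = 0 only when the generator vanishes; then dt is the junk value T / 0 = 0. *)
  have P00 : P = 0.
    apply/eqP; apply: contraT => Pn0; have Pp : 0 < P by rewrite lt_def Pn0.
    have : 0 < z.
      rewrite !mulr_gt0 ?powR_gt0 ?sqrtr_gt0 ?divr_gt0 ?mulr_gt0 //.
      by rewrite ltr_wpDr // mulr_ge0.
    by rewrite ltNge; move: zr; rewrite r0 => ->.
  have hL0 : dbound (lindbladian H L) 0.
    apply: dbound_le (dboundD hH hD); move: P00; rewrite PE => wv0; lra.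
  apply: (@eq_dbound _ _ _ _ _ _ (dbound_le (ltW eps0)
    (exp_super_near_id lL (ltW T0) hL0))) => X.
  by rewrite /= averaged_trotter // r0.
have rR : 0 < r%:R :> R by rewrite ltr0n.
have dt0 : 0 < dt by rewrite dtE divr_gt0.
have rdt : r%:R * dt = T by rewrite dtE mulrC divfK // gt_eqF.
have y0 : 0 <= (h / 2 + x) * dt by rewrite mulr_ge0 ?(ltW dt0) // addr_ge0 // divr_ge0.
have e0 : 0 <= 20^-1 * (eps / r%:R) by rewrite mulr_ge0 // divr_ge0 // ltW.
have cx0 : 0 <= c0 * (x * dt) ^+ 3.
  by rewrite mulr_ge0 // exprn_ge0 // mulr_ge0 // ltW.
have linB (F G : 'M[R[i]]_(2 ^ n) -> 'M[R[i]]_(2 ^ n)) :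
    linear F -> linear G -> linear (F \- G).
  by move=> lF lG a X Y; rewrite /= lF lG scalerBr opprD addrACA.
have hK' := dbound_le hK (diamond_dbound (linB _ _ (exp_super_linear (dt / 2) lH) lK)).
have hN' := dbound_le (hN dt dt0 y1)
  (diamond_dbound (linB _ _ (exp_super_linear dt lD) (ss_channel_linear (N dt)))).
have step := trotter_step qK h0 x0 (ltW dt0) e0 cx0 hH hD y1 hK' hN'.
have lS : linear (K \o (ss_channel (N dt) \o K)).
  by move=> a X Y; rewrite /= lK ss_channel_linear lK.
have S1 : dbound (K \o (ss_channel (N dt) \o K)) 1.
  have := dbound_comp ler01 (channel_dbound qK)
    (dbound_comp ler01 (ss_channel_dbound (N dt)) (channel_dbound qK)).
  by rewrite !mul1r.
have Z1 := lindblad_contraction L HH (ltW dt0).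
set e := _ + _ in step.
have ee0 : 0 <= e.
  by apply: addr_ge0; [apply: addr_ge0; exact: mulr_ge0|];
     apply: mulr_ge0 => //; exact: exprn_ge0.
have tot := dbound_iterB r lS ee0 S1 Z1 step.
apply: (@eq_dbound _ _ _ _ _ _ (dbound_le _ tot)) => [X|].
  rewrite /= averaged_trotter // -exp_super_iter ?(ltW dt0) //.
  by rewrite rdt.
(* h <= 2 w and x <= 2 v give h / 2 + x <= w + 2 v <= 2 P. *)
have yP : (h / 2 + x) * dt <= 2 * (P * T) / r%:R.
  have -> : 2 * (P * T) / r%:R = 2 * P * dt by rewrite dtE; ring.
  by rewrite ler_wpM2r ?(ltW dt0) //; lra.
have PT0 : 0 <= P * T by rewrite mulr_ge0 // ltW.
apply: le_trans (error_budget c00 eps0 rR PT0 y0 yP zr).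
have xy : (x * dt) ^+ 3 <= ((h / 2 + x) * dt) ^+ 3.
  apply: lerXn2r; rewrite ?nnegrE ?mulr_ge0 ?(ltW dt0) ?addr_ge0 ?divr_ge0 //.
  by rewrite ler_wpM2r ?(ltW dt0) // lerDr divr_ge0.
apply: ler_wpM2l (ltW rR) _ _ _; rewrite /e.
have := ler_wpM2l c00 xy; lra.
Qed.
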